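(* Let $\gamma\in\mathbb{R}\setminus\{0\}$ and $\omega\in\mathbb{R}$. Then the stationary equation $$-\partial_x^2\varphi-\gamma\delta(x)\varphi+\omega\varphi-\varphi\,\mathrm{Log}|\varphi|^2=0\quad\text{in } W'(\mathbb{R})$$ has a unique nonnegative nontrivial solution $\varphi\in W(\mathbb{R})$, and this solution is $$\phi_{\omega,\gamma}(x)=e^{\frac{\omega+1}{2}}\,e^{-\frac12\left(|x|+\frac{\gamma}{2}\right)^2}.$$ Moreover, the set $\mathcal{A}_{\omega,\gamma}$ of all (complex-valued) $\varphi\in W(\mathbb{R})\setminus\{0\}$ that solve the stationary equation in $W'(\mathbb{R})$ is $\mathcal{A}_{\omega,\gamma}=\{e^{i\theta}\phi_{\omega,\gamma}:\theta\in\mathbb{R}\}$.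
   Context: All functions of $x\in\mathbb{R}$ are complex-valued unless stated otherwise, $\mathrm{Log}$ is the natural logarithm, and $0\,\mathrm{Log}\,0=0$. $W(\mathbb{R})=\{u\in H^1(\mathbb{R}): |u|^2\mathrm{Log}|u|^2\in L^1(\mathbb{R})\}$. This is a reflexive Banach space $W(\mathbb{R})=H^1(\mathbb{R})\cap L^A(\mathbb{R})$ with norm $\|u\|_{W(\mathbb{R})}=\|u\|_{H^1}+\|u\|_{L^A}$, where $A(s)=-s^2\mathrm{Log}(s^2)$ for $0\le s\le e^{-3}$, $A(s)=3s^2+4e^{-3}s-e^{-6}$ for $s\ge e^{-3}$, $L^A(\mathbb{R})=\{u\in L^1_{loc}(\mathbb{R}): A(|u|)\in L^1(\mathbb{R})\}$ and $\|u\|_{L^A}=\inf\{k>0:\int_{\mathbb{R}}A(k^{-1}|u|)\,dx\le 1\}$. $W'(\mathbb{R})$ is its (real) dual. The stationary equation in $W'(\mathbb{R})$ means: for all $h\in W(\mathbb{R})$, $\Re\left[\int\varphi'\overline{h'}\,dx+\omega\int\varphi\overline{h}\,dx-\int\varphi\,\mathrm{Log}|\varphi|^2\,\overline{h}\,dx\right]-\gamma\Re[\varphi(0)\overline{h(0)}]=0$. *)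

(* Defs.v *)
From HB Require Import structures.
From mathcomp Require Export all_boot all_order all_algebra.
From mathcomp Require Export all_classical all_reals all_analysis.
From mathcomp Require Export complex.
Set Implicit Arguments.
Unset Strict Implicit.
Unset Printing Implicit Defensive.
Import Order.TTheory GRing.Theory Num.Theory.
Import numFieldNormedType.Exports.
Export numFieldNormedType.Exports.

Local Open Scope classical_set_scope.
Local Open Scope ring_scope.
Local Open Scope complex_scope.

Section defs.
Variable R : realType.
Local Notation C := R[i].
Local Notation mu := (@lebesgue_measure R).
Implicit Types (u v w h phi : R -> C) (psi : R -> R).

(* The modulus as an element of R (the norm `|z| of R[i] lives in R[i]) *)
Definition cabs (z : C) : R := ComplexField.Normc.normc z.

Definition cexpi (theta : R) : C := cos theta +i* sin theta.

Definition cmeasurable u : Prop :=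
  measurable_fun setT (fun x => complex.Re (u x)) /\
  measurable_fun setT (fun x => complex.Im (u x)).

Definition cintegral u : C :=
  (\int[mu]_x complex.Re (u x))%R +i* (\int[mu]_x complex.Im (u x))%R.

(* Elements of L^2, H^1, W are represented by Borel functions; two functions
   denote the same element iff they are related by cae_eq. *)
Definition cae_eq u v : Prop := {ae mu, forall x, u x = v x}.

Definition cL2 u : Prop :=
  cmeasurable u /\ mu.-integrable setT (fun x => (cabs (u x) ^+ 2)%:E).

Definition test_function psi : Prop :=
  (forall (n : nat) (x : R), derivable (derive1n n psi) x 1) /\
  compact (closure [set x | psi x != 0]).

(* Real test functions suffice, both sides being complex linear in psi *)
Definition is_weak_derivative u v : Prop :=
  forall psi, test_function psi ->
    cintegral (fun x => u x * (derive1 psi x)%:C) =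
    - cintegral (fun x => v x * (psi x)%:C).

Definition H1 u : Prop :=
  cL2 u /\ exists v, cL2 v /\ is_weak_derivative u v.

(* The weak derivative of u in H^1, a function determined up to cae_eq *)
Definition wderiv u : R -> C :=
  xget (fun=> 0) [set v | cL2 v /\ is_weak_derivative u v].

(* The continuous representative of u in H^1; point values such as u(0)
   refer to it *)
Definition crepr u : R -> C :=
  xget (fun=> 0)
    [set w | [/\ continuous (fun x => complex.Re (w x)),
                 continuous (fun x => complex.Im (w x)) & cae_eq w u]].

(* 0 Log 0 = 0 holds since the factor cabs (u x) ^+ 2 vanishes *)
Definition W u : Prop :=
  H1 u /\
  mu.-integrable setT (fun x => (cabs (u x) ^+ 2 * ln (cabs (u x) ^+ 2))%:E).

Definition stationary (gamma omega : R) phi : Prop :=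
  forall h, W h ->
    complex.Re
      (cintegral (fun x => wderiv phi x * (wderiv h x)^*)
       + omega%:C * cintegral (fun x => phi x * (h x)^*)
       - cintegral (fun x => phi x * (ln (cabs (phi x) ^+ 2))%:C * (h x)^*))
    - gamma * complex.Re (crepr phi 0 * (crepr h 0)^*) = 0.

Definition nontrivial u : Prop := ~ cae_eq u (fun=> 0).

(* In R[i], 0 <= z means that z is real and nonnegative *)
Definition nonnegative u : Prop := {ae mu, forall x, 0 <= u x}.

Definition solution_set (gamma omega : R) : set (R -> C) :=
  [set phi | [/\ W phi, nontrivial phi & stationary gamma omega phi]].

Definition phi_sol (omega gamma : R) : R -> C := fun x =>
  (expR ((omega + 1) / 2) * expR (- (1 / 2) * (`|x| + gamma / 2) ^+ 2))%:C.

End defs.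

(* Main.v *)
(* Write a solution as [u], its continuous representative. Since [u ln |u|^2] is
   continuous, testing against smooth functions shows that [u] is C^2 off the
   origin, where [u'' = (omega - ln |u|^2) u], and that [u'] jumps by [- gamma u(0)]
   at 0. On each half-line the energy
     [|u'|^2 - (omega + 1) |u|^2 + |u|^2 ln |u|^2]
   and the Wronskian [Im (conj u * u')] are constant; they are integrable because
   [u] is in [W], so both vanish. Hence, where [u] does not vanish, [m = u' / u] is
   real with [m^2 = omega + 1 - ln |u|^2] and [m' = -1], so that [u] is there a
   Gaussian [k exp (- (x + a)^2 / 2)] with [|k|^2 = exp (omega + 1)]. Being such a
   Gaussian is an open and closed condition, so it holds on the whole half-line or
   [u] vanishes there. Continuity at 0 gives the same [k] and the same [a^2] on both
   sides, and the jump condition then determines [a], as [gamma != 0].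
   Conversely, the second distributional derivative of the Gausson is its pointwise
   one plus a Dirac mass at 0, which may be tested against any function of H^1:
   an integrable function with integrable weak derivative [v] has
   [int_(x > 0) v = - u(0)], by cutting off at scale [n]. *)
Require Import Defs.
From mathcomp Require Import measurable_realfun ring lra.
Set Implicit Arguments.
Unset Strict Implicit.
Unset Printing Implicit Defensive.
Import Order.TTheory GRing.Theory Num.Theory.
Import numFieldNormedType.Exports.
Local Open Scope classical_set_scope.
Local Open Scope ring_scope.
Local Open Scope complex_scope.
Local Notation "f ^` ()" := (derive1 f) : ring_scope.
Local Notation "f ^` ( n )" := (derive1n n f) : ring_scope.

(** * Smooth functions *)

Section pointwise_calculus.
Variable R : realType.
Implicit Types (f g : R -> R) (a b x : R).

Lemma continuous_cst a : continuous (fun _ : R => a).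
Proof. by move=> x; exact: cvg_cst. Qed.

Lemma continuous_add f g : continuous f -> continuous g ->
  continuous (fun x => f x + g x).
Proof. by move=> cf cg x; exact: (continuousD (cf x) (cg x)). Qed.

Lemma continuous_sub_cst f a : continuous f -> continuous (fun x => f x - a).
Proof. by move=> cf; apply: continuous_add => //; exact: continuous_cst. Qed.

Lemma continuous_opp f : continuous f -> continuous (fun x => - f x).
Proof. by move=> cf x; exact: (continuousN (cf x)). Qed.

Lemma continuous_mul f g : continuous f -> continuous g ->
  continuous (fun x => f x * g x).
Proof. by move=> cf cg x; exact: (continuousM (cf x) (cg x)). Qed.

Lemma continuous_abs f : continuous f -> continuous (fun x => `|f x|).
Proof.
by move=> cf x; apply: (@continuous_comp _ _ _ f);
  [exact: cf|exact: norm_continuous].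
Qed.

Lemma continuous_neq_near f x a : {for x, continuous f} -> f x != a ->
  \forall y \near x, f y != a.
Proof.
by move=> cf fxa; exact: (cf _ (open_nbhs_nbhs (conj (@open_neq _ a) fxa))).
Qed.

Lemma continuous_eq_closure f g (A : set R) : continuous f -> continuous g ->
  {in A, f =1 g} -> {in closure A, f =1 g}.
Proof.
move=> cf cg fg x; rewrite inE => clAx; apply: contrapT => /eqP.
rewrite -subr_eq0 => /(continuous_neq_near (continuousB (cf x) (cg x)))/clAx
  [y [Ay]].
by rewrite fctE (fg y) ?inE// subrr eqxx.
Qed.

Lemma continuous_eq_gt f g a : continuous f -> continuous g ->
  (forall x, a < x -> f x = g x) -> f a = g a.
Proof.
move=> cf cg fg; apply: (continuous_eq_closure (A := [set x | a < x]) cf cg).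
  by move=> x; rewrite inE; exact: fg.
by rewrite inE closure_gt/=.
Qed.

Lemma continuous_eq_lt f g a : continuous f -> continuous g ->
  (forall x, x < a -> f x = g x) -> f a = g a.
Proof.
move=> cf cg fg; apply: (continuous_eq_closure (A := [set x | x < a]) cf cg).
  by move=> x; rewrite inE; exact: fg.
by rewrite inE closure_lt/=.
Qed.

Lemma is_derive_continuous f x a : is_derive x 1 f a -> {for x, continuous f}.
Proof. by move=> [df _]; exact/differentiable_continuous/derivable1_diffP. Qed.

Lemma is_derive_unique f x a b : is_derive x 1 f a -> is_derive x 1 f b ->
  a = b.
Proof. by move=> [_ <-] [_ <-]. Qed.

Lemma is_derive_derive1 f f' : (forall x, is_derive x 1 f (f' x)) -> f^`() = f'.
Proof.
by move=> ff'; apply/funext => x; rewrite derive1E; have [_ ->] := ff' x.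
Qed.

(* The library states the derivation rules for [f + g], [f * g], ... in the ring
   of functions. *)
Lemma is_derive1D f g x a b : is_derive x 1 f a -> is_derive x 1 g b ->
  is_derive x 1 (fun y => f y + g y) (a + b).
Proof. exact: is_deriveD. Qed.

Lemma is_derive1N f x a : is_derive x 1 f a ->
  is_derive x 1 (fun y => - f y) (- a).
Proof. exact: is_deriveN. Qed.

Lemma is_derive1M f g x a b : is_derive x 1 f a -> is_derive x 1 g b ->
  is_derive x 1 (fun y => f y * g y) (f x * b + g x * a).
Proof. exact: is_deriveM. Qed.

Lemma is_derive1X f n x a : is_derive x 1 f a ->
  is_derive x 1 (fun y => f y ^+ n) (n%:R * f x ^+ n.-1 * a).
Proof.
move=> df; have := is_deriveX n df.
by rewrite -[_ *: _]/(_ * _) (_ : f ^+ n = fun y => f y ^+ n)// exprfctE.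
Qed.

Lemma is_derive1V f x a : f x != 0 -> is_derive x 1 f a ->
  is_derive x 1 (fun y => (f y)^-1) (- (f x) ^- 2 * a).
Proof. exact: is_deriveV. Qed.

Lemma is_derive_addr x a : is_derive x 1 (fun y => y + a) 1.
Proof.
by apply: (is_derive_eq (is_derive1D (is_derive_id x 1) (is_derive_cst a x 1)));
  rewrite addr0.
Qed.

Lemma is_derive_mull x a : is_derive x 1 (fun y => a * y) a.
Proof.
apply: (is_derive_eq (is_derive1M (is_derive_cst a x 1) (is_derive_id x 1))).
by rewrite /= mulr1 mulr0 addr0.
Qed.

Lemma is_derive1M_zero f g x a : f x = 0 -> is_derive x 1 f a ->
  {for x, continuous g} -> is_derive x 1 (fun y => f y * g y) (a * g x).
Proof.
move=> fx0 /is_derive1_caratheodory[h [fE ch ha]] cg.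
apply/is_derive1_caratheodory; exists (fun y => h y * g y); split.
- by move=> y; rewrite fx0 mul0r subr0 -[f y]subr0 -fx0 fE mulrAC.
- exact: continuousM.
- by rewrite ha.
Qed.

Lemma is_derive0_eq_on (A : set R) f : is_interval A ->
  (forall x : R, A x -> is_derive x 1 f 0) -> forall x y, A x -> A y ->
  f x = f y.
Proof.
move=> itvA df x y; wlog xy : x y / x < y.
  move=> eqf Ax Ay; have [xy|yx|->//] := ltgtP x y; first exact: eqf.
  exact/esym/eqf.
move=> Ax Ay; have dfxy z : x <= z <= y -> is_derive z 1 f 0.
  by move=> xzy; apply: df; exact: (itvA x y).
have [] := @MVT _ f (cst 0) x y xy.
- by move=> z; rewrite in_itv/= => /andP[xz zy]; apply: dfxy; rewrite !ltW.
- apply: continuous_in_subspaceT => z; rewrite inE/= in_itv/= => /dfxy.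
  exact: is_derive_continuous.
- by move=> z _; rewrite /= mul0r => /eqP; rewrite subr_eq0 => /eqP.
Qed.

End pointwise_calculus.

Section smooth.
Variable R : realType.
Implicit Types (f g : R -> R) (n k : nat) (x : R).

Definition nderivable n f := forall k, (k < n)%N ->
  forall x, derivable f^`(k) x 1.

Definition smooth f := forall n x, derivable f^`(n) x 1.

Lemma smoothP f : smooth f <-> forall n, nderivable n f.
Proof.
split=> [sf n k _ x|nf n x]; first exact: sf.
exact: (nf n.+1).
Qed.

Lemma derive1n_derive1 n f : (f^`())^`(n) = f^`(n.+1).
Proof. by rewrite /derive1n iterSr. Qed.

Lemma nderivable_is_derive n f x : nderivable n.+1 f ->
  is_derive x 1 f (f^`() x).
Proof.
by move=> nf; rewrite derive1E; apply: DeriveDef => //; exact: (nf 0%N).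
Qed.

Lemma nderivable_derive1 n f : nderivable n.+1 f -> nderivable n f^`().
Proof. by move=> nf k kn x; rewrite derive1n_derive1; exact: nf. Qed.

Lemma nderivableW n f : nderivable n.+1 f -> nderivable n f.
Proof. by move=> nf k kn; apply: nf; exact: ltnW. Qed.

Lemma nderivableS n f f' : (forall x, is_derive x 1 f (f' x)) ->
  nderivable n f' -> nderivable n.+1 f.
Proof.
move=> ff' nf' [_ x|k kn x]; first by have [] := ff' x.
by rewrite -derive1n_derive1 (is_derive_derive1 ff'); exact: nf'.
Qed.

Lemma nderivable0 f : nderivable 0 f. Proof. by move=> k; rewrite ltn0. Qed.

Lemma nderivable_cst n (c : R) : nderivable n (fun=> c).
Proof. by elim: n c => [//|n IHn] c; exact: (@nderivableS _ _ (fun=> 0)). Qed.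

Lemma nderivableD n f g : nderivable n f -> nderivable n g ->
  nderivable n (fun x => f x + g x).
Proof.
elim: n f g => [f g _ _|n IHn f g nf ng]; first exact: nderivable0.
apply: (nderivableS (fun x => is_derive1D (nderivable_is_derive x nf)
                                          (nderivable_is_derive x ng))).
by apply: IHn; exact: nderivable_derive1.
Qed.

Lemma nderivableM n f g : nderivable n f -> nderivable n g ->
  nderivable n (fun x => f x * g x).
Proof.
elim: n f g => [f g _ _|n IHn f g nf ng]; first exact: nderivable0.
apply: (nderivableS (fun x => is_derive1M (nderivable_is_derive x nf)
                                          (nderivable_is_derive x ng))).
by apply: nderivableD; apply: IHn (nderivableW _) (nderivable_derive1 _).
Qed.

Lemma nderivable_comp n f g : nderivable n f -> nderivable n g ->
  nderivable n (fun x => f (g x)).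
Proof.
elim: n f g => [f g _ _|n IHn f g nf ng]; first exact: nderivable0.
apply: (nderivableS (fun x => is_derive1_comp (nderivable_is_derive (g x) nf)
                                              (nderivable_is_derive x ng))).
apply: nderivableM (nderivable_derive1 ng).
by apply: IHn; [exact: nderivable_derive1|exact: nderivableW].
Qed.

Lemma nderivableV n f : (forall x, f x != 0) -> nderivable n f ->
  nderivable n (fun x => (f x)^-1).
Proof.
move=> f0; elim: n => [_|n IHn nf]; first exact: nderivable0.
have nV : nderivable n (fun x => (f x)^-1) by apply: IHn; exact: nderivableW.
have dV x : is_derive x 1 (fun y => (f y)^-1)
  (-1 * ((f x)^-1 * (f x)^-1) * f^`() x).
  apply: (is_derive_eq (is_derive1V (f0 x) (nderivable_is_derive x nf))).
  by field; exact: f0.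
apply: (nderivableS dV); apply: nderivableM (nderivable_derive1 nf).
exact: (nderivableM (@nderivable_cst _ _) (nderivableM nV nV)).
Qed.

Lemma smooth_derive1 f : smooth f -> smooth f^`().
Proof. by move=> sf n x; rewrite derive1n_derive1; exact: sf. Qed.

Lemma smooth_is_derive f x : smooth f -> is_derive x 1 f (f^`() x).
Proof. by move=> /smoothP/(_ 1%N)/nderivable_is_derive. Qed.

Lemma smooth_continuous f : smooth f -> continuous f.
Proof. by move=> sf x; exact: is_derive_continuous (smooth_is_derive x sf). Qed.

Lemma smooth_cst (c : R) : smooth (fun=> c).
Proof. by apply/smoothP => n; exact: nderivable_cst. Qed.

Lemma smooth_id : smooth (fun x : R => x).
Proof.
by apply/smoothP => -[//|n];
  exact: (nderivableS (fun x => is_derive_id x 1) (@nderivable_cst n 1)).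
Qed.

Lemma smooth_add f g : smooth f -> smooth g -> smooth (fun x => f x + g x).
Proof.
by move=> /smoothP nf /smoothP ng; apply/smoothP => n; exact: nderivableD.
Qed.

Lemma smooth_mul f g : smooth f -> smooth g -> smooth (fun x => f x * g x).
Proof.
by move=> /smoothP nf /smoothP ng; apply/smoothP => n; exact: nderivableM.
Qed.

Lemma smooth_comp f g : smooth f -> smooth g -> smooth (fun x => f (g x)).
Proof.
by move=> /smoothP nf /smoothP ng; apply/smoothP => n; exact: nderivable_comp.
Qed.

Lemma smooth_inv f : (forall x, f x != 0) -> smooth f ->
  smooth (fun x => (f x)^-1).
Proof. by move=> f0 /smoothP nf; apply/smoothP => n; exact: nderivableV. Qed.

Lemma smooth_opp f : smooth f -> smooth (fun x => - f x).
Proof.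
move=> /(smooth_mul (@smooth_cst (-1))); congr smooth.
by apply/funext => x; rewrite mulN1r.
Qed.

Lemma smooth_expR : smooth (@expR R).
Proof.
by apply/smoothP; elim=> [|n]; [exact: nderivable0|exact: nderivableS].
Qed.

End smooth.

Section smoothstep.
Variable R : realType.
Implicit Types (n k : nat) (x : R).

Lemma expn_le_fact_expR n x : 0 <= x -> x ^+ n <= n`!%:R * expR x.
Proof.
case: n => [|n] x0; first by rewrite expr0 fact0 mul1r -expR0 ler_expR.
rewrite mulrC -ler_pdivrMr ?ltr0n ?fact_gt0//.
by apply: le_trans (expR_ge1Dxn n x0); rewrite lerDr.
Qed.

Definition flat k x : R := if 0 < x then x^-1 ^+ k * expR (- x^-1) else 0.

Lemma flat0 k x : x <= 0 -> flat k x = 0.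
Proof. by rewrite /flat; case: ltP. Qed.

Lemma flat_gt0 k x : 0 < x -> 0 < flat k x.
Proof.
by move=> x0; rewrite /flat x0 mulr_gt0 ?expR_gt0// exprn_gt0// invr_gt0.
Qed.

Lemma flat_ge0 k x : 0 <= flat k x.
Proof. by have [/flat0->|/(flat_gt0 k)/ltW] := leP x 0. Qed.

Lemma flat_le_norm k x : flat k x <= k.+1`!%:R * `|x|.
Proof.
have [x0|x0] := leP x 0; first by rewrite flat0// mulr_ge0.
have V0 : 0 < x^-1 by rewrite invr_gt0.
rewrite /flat x0 expRN ler_pdivrMr ?expR_gt0// gtr0_norm//.
rewrite -(@ler_pM2l _ x^-1)// -exprS.
apply: le_trans (expn_le_fact_expR _ (ltW V0)) _.
by rewrite le_eqVlt; apply/orP; left; apply/eqP; field; rewrite gt_eqF.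
Qed.

Lemma flat_continuous0 k : {for 0, continuous (flat k)}.
Proof.
rewrite /prop_for /continuous_at (flat0 k (lexx 0)).
apply: norm_cvg0.
apply: (@squeeze_cvgr _ _ _ _ (fun=> 0) (fun x => k.+1`!%:R * `|x|)).
- by apply: nearW => x; rewrite normr_ge0 ger0_norm ?flat_ge0 ?flat_le_norm.
- exact: cvg_cst.
- have := continuous_mul (@continuous_cst R k.+1`!%:R) (@norm_continuous _ R^o).
  by move=> /(_ 0); rewrite /continuous_at normr0 mulr0.
Qed.

Lemma is_derive_flat k x :
  is_derive x 1 (flat k) (- k%:R * flat k.+1 x + flat k.+2 x).
Proof.
have [x0|x0|->] := ltgtP x 0.
- rewrite !flat0 ?ltW// mulr0 addr0; apply: (@near_eq_is_derive _ _ _ (cst 0)).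
  by near=> z; rewrite flat0//; near: z; exact: lt_le_nbhsl.
- apply: (@near_eq_is_derive _ _ _ (fun x : R => x^-1 ^+ k * expR (- x^-1))).
    by near=> z; rewrite /flat ifT//; near: z; exact: lt_nbhsr.
  have dV := is_derive1V (lt0r_neq0 x0 : id x != 0) (is_derive_id x 1).
  have dexp := is_derive1_comp (is_derive_expR _) (is_derive1N dV).
  apply: (is_derive_eq (is_derive1M (is_derive1X k dV) dexp));
    rewrite /flat x0 /=.
  by case: k => [|k] /=; rewrite ?expr0 !exprS ?expr0; field; rewrite gt_eqF.
- rewrite !flat0// mulr0 addr0.
  (* the difference quotient of [flat k] at 0 is [flat k.+1] *)
  apply/is_derive1_caratheodory; exists (flat k.+1); split.
  + move=> z; rewrite (flat0 k (lexx 0)) !subr0.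
    have [/[dup]z0 /flat0->|z0] := leP z 0; first by rewrite flat0// mul0r.
    by rewrite /flat z0 exprS; field; rewrite gt_eqF.
  + exact: flat_continuous0.
  + by rewrite flat0.
Unshelve. all: by end_near. Qed.

Lemma smooth_flat k : smooth (flat k).
Proof.
apply/smoothP => n; elim: n k => [//|n IHn] k;
  apply: (nderivableS (is_derive_flat k)).
by apply: nderivableD => //; apply: nderivableM => //; exact: nderivable_cst.
Qed.

Definition smoothstep x : R := flat 0 x * (flat 0 x + flat 0 (1 - x))^-1.

Lemma smoothstep_den_gt0 x : 0 < flat 0 x + flat 0 (1 - x).
Proof.
have [x0|x0] := ltP 0 x; first by rewrite ltr_wpDr ?flat_ge0// flat_gt0.
by rewrite ltr_wpDl ?flat_ge0// flat_gt0//; lra.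
Qed.

Lemma smooth_smoothstep : smooth smoothstep.
Proof.
apply: smooth_mul; first exact: smooth_flat.
apply: smooth_inv => [x|]; first by rewrite gt_eqF// smoothstep_den_gt0.
apply: smooth_add; first exact: smooth_flat.
apply: (@smooth_comp _ _ (fun x => 1 - x)); first exact: smooth_flat.
by apply: smooth_add; [exact: smooth_cst|exact/smooth_opp/smooth_id].
Qed.

Lemma smoothstep0 x : x <= 0 -> smoothstep x = 0.
Proof. by move=> x0; rewrite /smoothstep flat0// mul0r. Qed.

Lemma smoothstep1 x : 1 <= x -> smoothstep x = 1.
Proof.
move=> x1; rewrite /smoothstep (@flat0 _ (_ - _)); last by lra.
by rewrite addr0 divff// gt_eqF// flat_gt0//; lra.
Qed.

Lemma smoothstep_ge0 x : 0 <= smoothstep x.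
Proof. by rewrite mulr_ge0 ?flat_ge0// invr_ge0 ltW// smoothstep_den_gt0. Qed.

Lemma smoothstep_le1 x : smoothstep x <= 1.
Proof. by rewrite ler_pdivrMr ?smoothstep_den_gt0// mul1r lerDl flat_ge0. Qed.

Lemma derive1_smoothstep_out x : (x < 0) || (1 < x) -> smoothstep^`() x = 0.
Proof.
move=> x01; suff d0 : is_derive x 1 smoothstep 0.
  exact: is_derive_unique (smooth_is_derive x smooth_smoothstep) d0.
case/orP: x01 => x0.
- apply: (@near_eq_is_derive _ _ _ (cst 0)).
  by near=> z; rewrite smoothstep0//; near: z; exact: lt_le_nbhsl.
- apply: (@near_eq_is_derive _ _ _ (cst (1 : R))).
  by near=> z; rewrite smoothstep1// ltW//; near: z; exact: lt_nbhsr.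
Unshelve. all: by end_near. Qed.

Lemma derive1_smoothstep_bounded : exists C, forall x, `|smoothstep^`() x| <= C.
Proof.
have cd := smooth_continuous (smooth_derive1 smooth_smoothstep).
have [c _ maxc] := EVT_max ler01 (continuous_subspaceT (continuous_abs cd)).
exists `|smoothstep^`() c| => x; have [x01|] := boolP (x \in `[0, 1]).
  exact: maxc.
rewrite in_itv/= negb_and -!ltNge => x01.
by rewrite derive1_smoothstep_out// normr0.
Qed.

End smoothstep.

(** * Integration on the real line *)

Section almost_everywhere.
Variable R : realType.
Local Notation mu := (@lebesgue_measure R).
Implicit Types (P Q S : R -> Prop) (f g : R -> R).

Lemma ae_imp P Q : (forall x, P x -> Q x) ->
  {ae mu, forall x, P x} -> {ae mu, forall x, Q x}.
Proof. by move=> PQ; apply: (@filterS _ _ (ae_filter_ringOfSetsType mu)). Qed.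

Lemma ae_imp2 P Q S : (forall x, P x -> Q x -> S x) ->
  {ae mu, forall x, P x} -> {ae mu, forall x, Q x} -> {ae mu, forall x, S x}.
Proof. by move=> PQS; apply: (@filterS2 _ _ (ae_filter_ringOfSetsType mu)). Qed.

Lemma ae_itv_exists P (a b : R) : a < b -> {ae mu, forall x, P x} ->
  exists2 x, a < x < b & P x.
Proof.
move=> ab [N [mN N0 PN]]; apply: contrapT => nex.
have abN : `]a, b[ `<=` N.
  move=> x; rewrite /= in_itv/= => xab; apply: PN => Px.
  by apply: nex; exists x.
have : (mu `]a, b[%classic <= mu N)%E by apply: le_measure; rewrite ?inE.
by rewrite N0 lebesgue_measure_itv/= lte_fin ab lee_fin leNgt subr_gt0 ab.
Qed.

Lemma ae_eq_continuous f g : continuous f -> continuous g ->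
  {ae mu, forall x, f x = g x} -> f = g.
Proof.
move=> cf cg fg; apply/funext => x.
apply: (continuous_eq_closure (A := [set x | f x = g x]) cf cg);
  first by move=> y; rewrite inE.
rewrite inE => V /nbhs_ballP[e /= e0 xeV].
have [y /andP[xy yx] fgy] : exists2 y, x - e < y < x + e & f y = g y.
  by apply: ae_itv_exists fg; lra.
by exists y; split => //; apply: xeV; rewrite /ball/= ltr_norml; apply/andP;
  split; lra.
Qed.

Lemma ae_eq_Rintegral f g : measurable_fun setT f -> measurable_fun setT g ->
  {ae mu, forall x, f x = g x} -> \int[mu]_x f x = \int[mu]_x g x.
Proof.
move=> mf mg fg; congr fine; apply: ae_eq_integral => //;
  do ?exact/measurable_EFinP.
by apply: ae_imp fg => x /= -> _.
Qed.

Lemma ae_eq_integrable f g : measurable_fun setT g ->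
  {ae mu, forall x, f x = g x} -> mu.-integrable setT (EFin \o f) ->
  mu.-integrable setT (EFin \o g).
Proof.
move=> mg fg /integrableP[mf foo]; apply/integrableP; split;
  first exact/measurable_EFinP.
rewrite (@ae_eq_integral _ _ _ mu setT (fun x => `|(EFin \o f) x|)%E) //.
- by apply: measurableT_comp => //; exact/measurable_EFinP.
- exact: measurableT_comp.
- by apply: ae_imp fg => x /= -> _.
Qed.

End almost_everywhere.

Section real_integrable.
Context {R : realType}.
Local Notation mu := (@lebesgue_measure R).
Variables (D : set R) (mD : measurable D).
Implicit Types (f g : R -> R).

Lemma RintegrableD f g : mu.-integrable D (EFin \o f) ->
  mu.-integrable D (EFin \o g) ->
  mu.-integrable D (EFin \o (fun x => f x + g x)).
Proof. by move=> fi gi; exact: (@integrableD _ _ _ mu D mD _ _ fi gi). Qed.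

Lemma RintegrableZ (c : R) f : mu.-integrable D (EFin \o f) ->
  mu.-integrable D (EFin \o (fun x => c * f x)).
Proof. by move=> fi; exact: (@integrableZl _ _ _ mu D mD c _ fi). Qed.

Lemma RintegrableB f g : mu.-integrable D (EFin \o f) ->
  mu.-integrable D (EFin \o g) ->
  mu.-integrable D (EFin \o (fun x => f x - g x)).
Proof. by move=> fi gi; exact: (@integrableB _ _ _ mu D mD _ _ fi gi). Qed.

Lemma le_Rintegrable f g : measurable_fun D f ->
  (forall x, D x -> `|f x| <= g x) ->
  mu.-integrable D (EFin \o g) -> mu.-integrable D (EFin \o f).
Proof.
move=> mf fg; apply: le_integrable => //; first exact/measurable_EFinP.
move=> x Dx; rewrite /= lee_fin (le_trans (fg x Dx))//; exact: ler_norm.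
Qed.

Lemma Rintegral_mul_indic f :
  \int[mu]_x (f x * \1_D x) = \int[mu]_(x in D) f x.
Proof.
rewrite [RHS]Rintegral_mkcond; apply: eq_Rintegral => x _.
by rewrite patchE indicE; case: ifP => _; rewrite ?mulr1 ?mulr0.
Qed.

Lemma integrable_mul_indic f : mu.-integrable D (EFin \o f) ->
  mu.-integrable setT (EFin \o (fun x => f x * \1_D x)).
Proof.
move=> fi; have : mu.-integrable setT ((EFin \o f) \_ D)
  by exact/(integrable_mkcond _ _).1.
apply: eq_integrable => // x _.
by rewrite /= patchE indicE; case: ifP => _; rewrite ?mulr1 ?mulr0.
Qed.

Lemma cvg_dominated_Rintegral (f_ : nat -> R -> R) f g :
  (forall n, measurable_fun D (f_ n)) ->
  (forall x, D x -> f_ ^~ x @ \oo --> f x) ->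
  mu.-integrable D (EFin \o g) ->
  (forall n x, D x -> `|f_ n x| <= g x) ->
  \int[mu]_(x in D) f_ n x @[n --> \oo] --> \int[mu]_(x in D) f x.
Proof.
move=> mf_ f_f gi fg.
have mf : measurable_fun D f by exact: (measurable_fun_cvg mf_).
have mEf_ n : measurable_fun D (EFin \o f_ n) by exact/measurable_EFinP.
have mEf : measurable_fun D (EFin \o f) by exact/measurable_EFinP.
have [|||fi _] := @dominated_convergence _ _ _ mu D mD
  (fun n => EFin \o f_ n) (EFin \o f) (EFin \o g) mEf_ mEf.
- by apply: aeW => x Dx; apply/fine_cvgP; split; [exact: nearW|exact: f_f].
- exact: gi.
- by apply: aeW => x n Dx; rewrite /= lee_fin; exact: fg.
by rewrite -(fineK (integrable_fin_num _ fi))// => /fine_cvgP[].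
Qed.

End real_integrable.

Section local_integrability.
Variable R : realType.
Local Notation mu := (@lebesgue_measure R).
Local Notation locint := (locally_integrable [set: R]).
Implicit Types (f g F : R -> R) (a b c x M : R).

Lemma locally_integrable_measurable f : locint f -> measurable_fun setT f.
Proof. by case. Qed.

Lemma locally_integrable_itv f a b : locint f ->
  mu.-integrable `[a, b] (EFin \o f).
Proof.
move=> [mf _ lf]; apply/integrableP; split.
  by apply/measurable_EFinP; exact: measurable_funS mf.
by apply: lf => //; exact: segment_compact.
Qed.

Lemma locally_integrable_of_itv f : measurable_fun setT f ->
  (forall M, mu.-integrable `[- M, M] (EFin \o f)) -> locint f.
Proof.
move=> mf iM; split=> //; first exact: openT.
move=> K _ cK; have [M [_ KM]] := compact_bounded cK.
have {}KM : K `<=` `[- (M + 1), M + 1].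
  by move=> x /(KM (M + 1)); rewrite /= in_itv/= ler_norml; apply;
    rewrite ltrDl.
have : mu.-integrable K (EFin \o f).
  by apply: integrableS (iM (M + 1)) => //; exact: compact_measurable.
by case/integrableP.
Qed.

Lemma continuous_locally_integrable f : continuous f -> locint f.
Proof.
move=> cf; apply: locally_integrable_of_itv;
  first exact: continuous_measurable_fun.
move=> M; apply: continuous_compact_integrable; first exact: segment_compact.
exact: continuous_subspaceT.
Qed.

Lemma locally_integrableM f g : locint f -> continuous g ->
  locint (fun x => f x * g x).
Proof.
move=> lf cg; have mg := continuous_measurable_fun cg.
apply: locally_integrable_of_itv => [|M].
  by apply: measurable_funM => //; exact: locally_integrable_measurable.
apply: (@integrableMl _ _ _ mu `[- M, M] _ (EFin \o f) g
  (locally_integrable_itv _ _ lf)) => //.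
  exact: measurable_funS mg.
have /compact_bounded[N [Nr gN]] : compact (g @` `[- M, M]).
  by apply: continuous_compact;
    [exact: continuous_subspaceT|exact: segment_compact].
by exists N; split=> // c Nc x xM; apply: (gN c) => //; exists x.
Qed.

Lemma Rintegral_itv_cat f a b c : locint f -> a <= b -> b <= c ->
  \int[mu]_(x in `[a, c]) f x =
  \int[mu]_(x in `[a, b]) f x + \int[mu]_(x in `[b, c]) f x.
Proof.
move=> lf ab bc.
have := @Rintegral_itvB _ f (BLeft a) (BRight c) b
  (locally_integrable_itv _ _ lf).
rewrite !bnd_simp => /(_ ab bc); rewrite Rintegral_itv_obnd_cbnd => [<-|].
  by rewrite addrC subrK.
by apply: integrableS (locally_integrable_itv b c lf) => //;
  exact: subset_itv_oc_cc.
Qed.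

Lemma Rintegral_is_derive f F a b : a <= b -> continuous f ->
  (forall x, is_derive x 1 F (f x)) ->
  \int[mu]_(x in `[a, b]) f x = F b - F a.
Proof.
rewrite le_eqVlt => /predU1P[->|ab] cf dF.
  by rewrite set_itv1 Rintegral_set1 subrr.
have cF x : {for x, continuous F} := is_derive_continuous (dF x).
rewrite /Rintegral (@continuous_FTC2 _ f F a b ab)//.
- exact: continuous_subspaceT.
- split; first by move=> x _; have [] := dF x.
  + exact/cvg_at_right_filter/cF.
  + exact/cvg_at_left_filter/cF.
- by move=> x _; rewrite (is_derive_derive1 dF).
Qed.

End local_integrability.

(** * Test functions *)

Section test_functions.
Variable R : realType.
Local Notation mu := (@lebesgue_measure R).
Local Notation locint := (locally_integrable [set: R]).
Implicit Types (f g psi : R -> R) (x M : R).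

Definition supported_in M f := forall x, M < `|x| -> f x = 0.

Lemma supported_inMl M f g : supported_in M g ->
  supported_in M (fun x => f x * g x).
Proof. by move=> gM x /gM ->; rewrite mulr0. Qed.

Lemma supported_in_derive1 M f : supported_in M f -> supported_in M f^`().
Proof.
move=> fM x Mx; suff [_ <-] : is_derive x 1 f 0 by rewrite derive1E.
apply: (@near_eq_is_derive _ _ _ (cst 0)).
near=> z; rewrite fM//; near: z.
exact: (@norm_continuous _ R^o x _ (lt_nbhsr Mx)).
Unshelve. all: by end_near. Qed.

Lemma Rintegral_supported_in M f : supported_in M f ->
  \int[mu]_x f x = \int[mu]_(x in `[- M, M]) f x.
Proof.
move=> fM; rewrite [RHS]Rintegral_mkcond; apply: eq_Rintegral => x _.
rewrite patchE; case: ifPn => //.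
by rewrite notin_setE/= in_itv/= => /negP; rewrite -ler_norml -ltNge => /fM.
Qed.

Lemma integrable_supported_in M f : locint f -> supported_in M f ->
  mu.-integrable setT (EFin \o f).
Proof.
move=> lf fM.
have := integrable_mul_indic (measurable_itv _)
  (locally_integrable_itv (- M) M lf).
apply: eq_integrable => // x _ /=; congr EFin; rewrite indicE.
have [|] := boolP (x \in `[- M, M]%classic); first by rewrite mulr1.
by rewrite notin_setE/= in_itv/= mulr0 => /negP;
  rewrite -ler_norml -ltNge => /fM.
Qed.

Lemma test_functionP psi :
  test_function psi <-> smooth psi /\ exists M, supported_in M psi.
Proof.
split=> [[spsi /compact_bounded[M [_ suppM]]]|[spsi [M psiM]]].
  split=> //; exists (M + 1) => x; apply: contraTeq => psix; rewrite -leNgt.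
  by apply: (suppM (M + 1)); [rewrite ltrDl|exact: subset_closure].
split=> //; apply: (subclosed_compact _ (@segment_compact _ (- M) M)).
  exact: closed_closure.
rewrite [X in _ `<=` X](closure_id _).1; last exact: interval_closed.
apply: closureS => x /= psix; rewrite in_itv/= -ler_norml leNgt.
by apply: contra_neqN psix => /psiM.
Qed.

Lemma test_smooth psi : test_function psi -> smooth psi.
Proof. by case/test_functionP. Qed.

Lemma test_derive1 psi : test_function psi -> test_function psi^`().
Proof.
move=> /test_functionP[spsi [M psiM]]; apply/test_functionP; split.
  exact: smooth_derive1.
by exists M; exact: supported_in_derive1.
Qed.

Lemma test_mull f psi : smooth f -> test_function psi ->
  test_function (fun x => f x * psi x).
Proof.
move=> sf /test_functionP[spsi [M psiM]]; apply/test_functionP; split.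
  exact: smooth_mul.
by exists M; exact: supported_inMl.
Qed.

Lemma integrable_test f psi : locint f -> test_function psi ->
  mu.-integrable setT (EFin \o (fun x => f x * psi x)).
Proof.
move=> lf /test_functionP[spsi [M psiM]].
apply: (@integrable_supported_in M); last exact: supported_inMl.
exact/locally_integrableM/smooth_continuous.
Qed.

Lemma test_integrable psi : test_function psi ->
  mu.-integrable setT (EFin \o psi).
Proof.
move=> /(integrable_test (continuous_locally_integrable (@continuous_cst R 1))).
by under eq_fun do rewrite mul1r.
Qed.

Lemma Rintegral_derive1_test psi : test_function psi ->
  \int[mu]_x psi^`() x = 0.
Proof.
move=> /test_functionP[spsi [M psiM]].
have psiM1 : supported_in (`|M| + 1) psi.
  by move=> x Mx; apply: psiM; have := ler_norm M; lra.
rewrite (Rintegral_supported_in (supported_in_derive1 psiM1)).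
have M0 := normr_ge0 M; have leM := ler_norm M.
have dpsi x := smooth_is_derive x spsi.
rewrite (Rintegral_is_derive _ (smooth_continuous (smooth_derive1 spsi)) dpsi);
  last lra.
by rewrite !psiM ?subrr// ?normrN ger0_norm; lra.
Qed.

End test_functions.

Section ramps.
Variable R : realType.
Local Notation mu := (@lebesgue_measure R).
Implicit Types (a b k l x : R).

Definition ramp k a x : R := smoothstep (k * (x - a)).

Let smooth_affine k a : smooth (fun x => k * (x - a)).
Proof.
apply: smooth_mul; first exact: smooth_cst.
by apply: smooth_add; [exact: smooth_id|exact: smooth_cst].
Qed.

Lemma smooth_ramp k a : smooth (ramp k a).
Proof. exact: (smooth_comp (@smooth_smoothstep R) (@smooth_affine k a)). Qed.

Lemma derive1_ramp k a x :
  (ramp k a)^`() x = k * (@smoothstep R)^`() (k * (x - a)).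
Proof.
have ds := smooth_is_derive (k * (x - a)) (@smooth_smoothstep R).
have da : is_derive x 1 (fun y => k * (y - a)) (k * 1).
  exact: (@is_derive1_comp _ (fun y => k * y) (fun y => y - a) x _ _
    (is_derive_mull _ _) (is_derive_addr _ _)).
suff dramp : is_derive x 1 (ramp k a) (k * (@smoothstep R)^`() (k * (x - a))).
  exact: is_derive_unique (smooth_is_derive x (@smooth_ramp k a)) dramp.
have dcomp := @is_derive1_comp _ (@smoothstep R) (fun y => k * (y - a))
  x _ _ ds da.
by apply: (is_derive_eq dcomp); rewrite mulr1 mulrC.
Qed.

Lemma ramp_ge0 k a x : 0 <= ramp k a x. Proof. exact: smoothstep_ge0. Qed.

Lemma ramp_le1 k a x : ramp k a x <= 1. Proof. exact: smoothstep_le1. Qed.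

Lemma ramp0 k a x : 0 < k -> x <= a -> ramp k a x = 0.
Proof. by move=> k0 xa; rewrite /ramp smoothstep0// pmulr_rle0// subr_le0. Qed.

Lemma ramp1 k a x : 0 < k -> a + k^-1 <= x -> ramp k a x = 1.
Proof.
by move=> k0 ax; rewrite /ramp smoothstep1// -ler_pdivrMl// mulr1 lerBrDl.
Qed.

Lemma derive1_ramp_out k a x : 0 < k -> (x < a) || (a + k^-1 < x) ->
  (ramp k a)^`() x = 0.
Proof.
move=> k0 xa; rewrite derive1_ramp derive1_smoothstep_out ?mulr0//.
by rewrite pmulr_rlt0// subr_lt0 -ltr_pdivrMl// mulr1 ltrBrDl.
Qed.

Lemma derive1_ramp_bounded : exists2 C, 0 < C &
  forall k a x, 0 < k -> `|(ramp k a)^`() x| <= k * C.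
Proof.
have [C leC] := derive1_smoothstep_bounded R; exists (`|C| + 1).
  by rewrite ltr_wpDl.
move=> k a x k0; rewrite derive1_ramp normrM gtr0_norm// ler_pM2l//.
by apply: le_trans (leC _) _; have := ler_norm C; lra.
Qed.

Lemma test_rampB k l a b : 0 < k -> 0 < l ->
  test_function (fun x => ramp k a x - ramp l b x).
Proof.
move=> k0 l0; apply/test_functionP; split.
  by apply: smooth_add; [|apply: smooth_opp]; exact: smooth_ramp.
exists (`|a| + `|b| + k^-1 + l^-1) => x.
have kV0 : 0 < k^-1 by rewrite invr_gt0.
have lV0 : 0 < l^-1 by rewrite invr_gt0.
have := ler_norm a; have := ler_norm (- a); have := ler_norm b;
  have := ler_norm (- b).
have := normr_ge0 a; have := normr_ge0 b.
rewrite !normrN ltr_normr => ? ? ? ? ? ? /orP[?|?].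
  by rewrite !ramp1 ?subrr//; lra.
by rewrite !ramp0 ?subrr//; lra.
Qed.

Lemma supported_in_derive1_ramp k a : 0 < k ->
  supported_in (`|a| + k^-1) (ramp k a)^`().
Proof.
move=> k0 x; rewrite ltr_normr => xa; have kV0 : 0 < k^-1 by rewrite invr_gt0.
have := ler_norm a; have := ler_norm (- a); rewrite normrN => ? ?.
by rewrite derive1_ramp_out//; case/orP: xa => ?; apply/orP; [right|left]; lra.
Qed.

Lemma test_derive1_ramp k a : 0 < k -> test_function (ramp k a)^`().
Proof.
move=> k0; apply/test_functionP; split; first exact/smooth_derive1/smooth_ramp.
by exists (`|a| + k^-1); exact: supported_in_derive1_ramp.
Qed.

Lemma Rintegral_derive1_ramp k a : 0 < k -> \int[mu]_x (ramp k a)^`() x = 1.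
Proof.
move=> k0; have kV0 : 0 < k^-1 by rewrite invr_gt0.
have a0 := normr_ge0 a; have lea := ler_norm a; have leNa := ler_norm (- a).
rewrite normrN in leNa.
have dramp x := smooth_is_derive x (@smooth_ramp k a).
rewrite (Rintegral_supported_in (@supported_in_derive1_ramp k a k0)).
rewrite (Rintegral_is_derive _
  (smooth_continuous (smooth_derive1 (@smooth_ramp k a))) dramp).
  by rewrite ramp1 ?ramp0 ?subr0//; lra.
lra.
Qed.

End ramps.

(** * Weak derivatives *)

Section approximate_identity.
Variable R : realType.
Local Notation mu := (@lebesgue_measure R).
Local Notation locint := (locally_integrable [set: R]).
Implicit Types (f rho : R -> R) (a r C x : R).

Lemma integral_mul_le_davg f rho a r C : 0 < r ->
  measurable_fun setT f -> measurable_fun setT rho ->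
  (forall x, `|rho x| <= C / r) -> (forall x, r <= `|x - a| -> rho x = 0) ->
  (\int[mu]_x `|(f x - f a) * rho x|%:E <= (2 * C)%:E * davg f a r)%E.
Proof.
move=> r0 mf mrho rho_le rho_out.
have C0 : 0 <= C.
  by rewrite -(@pmulr_lge0 _ r^-1) ?invr_gt0//; exact: le_trans (rho_le a).
have mfa : measurable_fun setT (fun x => f x - f a) by exact: measurable_funB.
pose F x := ((C / r)%:E * `|f x - f a|%:E)%E.
have mF : measurable_fun setT F.
  by apply: measurable_funeM; apply/measurable_EFinP; exact: measurableT_comp.
apply: (@le_trans _ _ (\int[mu]_x (F \_ (ball a r)) x)%E).
  apply: ge0_le_integral => //.
  - by apply/measurable_EFinP; apply: measurableT_comp => //;
      exact: measurable_funM.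
  - apply/(measurable_restrictT _ _).1; first exact: measurable_ball.
    exact: measurable_funS mF.
  - move=> x _; rewrite patchE; case: ifPn => xa.
      by rewrite /F -EFinM lee_fin normrM mulrC ler_wpM2r.
    rewrite rho_out ?mulr0 ?normr0//.
    by move: xa; rewrite notin_setE /ball/= distrC => /negP; rewrite -leNgt.
rewrite -integral_mkcond ge0_integralZl_EFin//; last 3 first.
- exact: measurable_ball.
- by apply/measurable_EFinP; apply: measurableT_comp => //;
    exact: measurable_funS mfa.
- by rewrite divr_ge0// ltW.
rewrite /davg /iavg (lebesgue_measure_ball _ (ltW r0)) inver.
rewrite ifF ?gt_eqF ?pmulrn_lgt0// muleA -EFinM.
by rewrite (_ : 2 * C / (r *+ 2) = C / r)// -mulr_natr; field; rewrite gt_eqF.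
Qed.

Lemma approximate_identity_cvg f a C (rho : nat -> R -> R) (r : nat -> R) :
  locint f -> lebesgue_pt f a ->
  (forall n, 0 < r n) -> r n @[n --> \oo] --> 0 ->
  (forall n, mu.-integrable setT (EFin \o rho n)) ->
  (forall n, mu.-integrable setT (EFin \o (fun x => f x * rho n x))) ->
  (forall n x, `|rho n x| <= C / r n) ->
  (forall n x, r n <= `|x - a| -> rho n x = 0) ->
  (forall n, \int[mu]_x rho n x = 1) ->
  \int[mu]_x (f x * rho n x) @[n --> \oo] --> f a.
Proof.
move=> lf fa r0 rcvg irho ifrho rho_le rho_out rho1.
have mrho n : measurable_fun setT (rho n).
  by apply/measurable_EFinP; exact: measurable_int (irho n).
pose err n := ((2 * C)%:E * davg f a (r n))%E.
have err_ge n : (`|f a - \int[mu]_x (f x * rho n x)|%:E <= err n)%E.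
  have ifarho := RintegrableB measurableT (ifrho n)
    (RintegrableZ measurableT (f a) (irho n)).
  have fa_rho : (fun x => f x * rho n x - f a * rho n x) =
      fun x => (f x - f a) * rho n x.
    by apply/funext => x; rewrite mulrBl.
  rewrite -{1}[f a]mulr1 -(rho1 n) -RintegralZl// distrC -RintegralB//;
    last exact: RintegrableZ.
  rewrite fa_rho in ifarho *; rewrite EFin_normr_Rintegral//.
  apply: le_trans (le_abse_integral _ measurableT (measurable_int _ ifarho)) _.
  apply: integral_mul_le_davg;
    [exact: r0| |exact: mrho|exact: rho_le|exact: rho_out].
  exact: locally_integrable_measurable lf.
have /fine_cvgP[fin_err cvg_err] : err n @[n --> \oo] --> 0%:E.
  rewrite -[0%:E](mule0 (2 * C)%:E); apply: cvgeZl => //.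
  by move/cvge_at_rightP: fa; apply.
apply/cvgrPdist_le => e e0; move/cvgrPdist_le: cvg_err => /(_ e e0) cvg_err.
near=> n; rewrite -lee_fin (le_trans (err_ge n))//.
have /fineK<- : err n \is a fin_num by near: n.
by rewrite lee_fin (le_trans (ler_norm _))// -normrN -sub0r; near: n.
Unshelve. all: by end_near. Qed.

End approximate_identity.

Section weak_derivative.
Variable R : realType.
Local Notation mu := (@lebesgue_measure R).
Local Notation locint := (locally_integrable [set: R]).
Implicit Types (f g u v w psi : R -> R) (a b c x k l : R) (n : nat).

Definition weak_derivative f g := forall psi, test_function psi ->
  \int[mu]_x (f x * psi^`() x) = - \int[mu]_x (g x * psi x).

Lemma weak_derivative_smooth f : smooth f -> weak_derivative f f^`().
Proof.
move=> sf psi tpsi; have spsi := test_smooth tpsi.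
have lf := continuous_locally_integrable (smooth_continuous sf).
have lf' := continuous_locally_integrable
  (smooth_continuous (smooth_derive1 sf)).
apply/eqP; rewrite -addr_eq0; apply/eqP.
rewrite -RintegralD//;
  [|exact: integrable_test lf (test_derive1 tpsi)|exact: integrable_test].
rewrite -[RHS](Rintegral_derive1_test (test_mull sf tpsi));
  apply: eq_Rintegral => x _.
apply/esym; suff df : is_derive x 1 (fun x => f x * psi x)
  (f x * psi^`() x + f^`() x * psi x).
  exact: is_derive_unique (smooth_is_derive x (smooth_mul sf spsi)) df.
apply: (is_derive_eq (is_derive1M (smooth_is_derive x sf)
  (smooth_is_derive x spsi))).
by rewrite [psi x * _]mulrC.
Qed.

Lemma weak_derivativeM f g w : locint f -> locint g -> smooth w ->
  weak_derivative f g ->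
  weak_derivative (fun x => f x * w x) (fun x => f x * w^`() x + g x * w x).
Proof.
move=> lf lg sw fg psi tpsi; have spsi := test_smooth tpsi.
have cw := smooth_continuous sw.
have cw' := smooth_continuous (smooth_derive1 sw).
have ifwpsi' := integrable_test (locally_integrableM lf cw) (test_derive1 tpsi).
have ifw'psi := integrable_test (locally_integrableM lf cw') tpsi.
have igwpsi := integrable_test (locally_integrableM lg cw) tpsi.
have dwpsi : (fun x => w x * psi x)^`() =
    fun x => w x * psi^`() x + psi x * w^`() x.
  apply: is_derive_derive1 => x.
  exact: is_derive1M (smooth_is_derive x sw) (smooth_is_derive x spsi).
have := fg _ (test_mull sw tpsi); rewrite dwpsi.
under eq_Rintegral => x _.
  rewrite (_ : f x * _ = f x * w x * psi^`() x + f x * w^`() x * psi x);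
    last by ring.
  over.
under [in RHS]eq_Rintegral => x _ do rewrite mulrA.
rewrite RintegralD// => fwpsi'.
under [in RHS]eq_Rintegral => x _ do rewrite mulrDl.
by rewrite RintegralD// opprD addrC -fwpsi' addrK.
Qed.

Lemma weak_derivativeZ c f g : locint f -> locint g -> weak_derivative f g ->
  weak_derivative (fun x => c * f x) (fun x => c * g x).
Proof.
move=> lf lg fg psi tpsi.
under eq_Rintegral do rewrite -mulrA.
under [in RHS]eq_Rintegral do rewrite -mulrA.
rewrite !RintegralZl//;
  [|exact: integrable_test|exact: integrable_test (test_derive1 tpsi)].
by rewrite fg// mulrN.
Qed.

Lemma weak_derivativeD f1 g1 f2 g2 :
  locint f1 -> locint g1 -> locint f2 -> locint g2 ->
  weak_derivative f1 g1 -> weak_derivative f2 g2 ->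
  weak_derivative (fun x => f1 x + f2 x) (fun x => g1 x + g2 x).
Proof.
move=> lf1 lg1 lf2 lg2 fg1 fg2 psi tpsi; have tpsi' := test_derive1 tpsi.
under eq_Rintegral do rewrite mulrDl.
under [in RHS]eq_Rintegral do rewrite mulrDl.
rewrite !RintegralD//; do ?exact: integrable_test.
by rewrite fg1// fg2// opprD.
Qed.

Lemma weak_derivative_ae_eq f1 f2 g1 g2 :
  measurable_fun setT f1 -> measurable_fun setT f2 ->
  measurable_fun setT g1 -> measurable_fun setT g2 ->
  {ae mu, forall x, f1 x = f2 x} -> {ae mu, forall x, g1 x = g2 x} ->
  weak_derivative f1 g1 -> weak_derivative f2 g2.
Proof.
move=> mf1 mf2 mg1 mg2 f12 g12 fg psi tpsi.
have mpsi := continuous_measurable_fun (smooth_continuous (test_smooth tpsi)).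
have mpsi' := continuous_measurable_fun
  (smooth_continuous (test_smooth (test_derive1 tpsi))).
rewrite -(@ae_eq_Rintegral _ (fun x => f1 x * psi^`() x));
  do ?exact: measurable_funM.
  rewrite fg//; congr (- _); apply: ae_eq_Rintegral; do ?exact: measurable_funM.
  by apply: ae_imp g12 => x ->.
by apply: ae_imp f12 => x ->.
Qed.

Lemma lebesgue_pt_continuous f a : continuous f -> lebesgue_pt f a.
Proof.
move=> cf; apply: (@continuous_lebesgue_pt _ _ _ setT); last exact: cf.
- by split=> //; exact: openT.
- exact: measurableT.
- exact: continuous_measurable_fun.
Qed.

Lemma derive1_ramp_cvg f a : locint f -> lebesgue_pt f a ->
  \int[mu]_x (f x * (ramp n.+1%:R a)^`() x) @[n --> \oo] --> f a.
Proof.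
move=> lf fa; have [C C0 ramp'_le] := derive1_ramp_bounded R.
have tramp' n : test_function (ramp n.+1%:R a)^`() by exact: test_derive1_ramp.
apply: (@approximate_identity_cvg _ f a (2 * C) _ (fun n => 2 / n.+1%:R)) => //.
- rewrite -[X in _ --> X](mulr0 2); apply: cvgM;
    [exact: cvg_cst|exact: cvg_harmonic].
- by move=> n; exact: test_integrable.
- by move=> n; exact: integrable_test.
- move=> n x; apply: le_trans (ramp'_le _ _ _ _) _ => //.
  by rewrite le_eqVlt; apply/orP; left; apply/eqP; field; rewrite gt_eqF.
- move=> n x; have V0 : 0 < n.+1%:R^-1 :> R by rewrite invr_gt0.
  move: V0 (@derive1_ramp_out _ n.+1%:R a x (ltr0Sn _ _));
    move: (n.+1%:R^-1) => d d0 out xa.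
  by apply: out; move: xa; rewrite ler_normr => /orP[?|?]; apply/orP;
    [right|left]; lra.
- by move=> n; exact: Rintegral_derive1_ramp.
Qed.

Lemma derive1_flat_ramp_cvg0 u (b : nat -> R) :
  mu.-integrable setT (EFin \o u) ->
  \int[mu]_x (u x * (ramp n.+1%:R^-1 (b n))^`() x) @[n --> \oo] --> (0 : R).
Proof.
move=> iu; have [C C0 ramp'_le] := derive1_ramp_bounded R.
have lu := open_integrable_locally openT iu.
have le_harmonic n :
    `|\int[mu]_x (u x * (ramp n.+1%:R^-1 (b n))^`() x)| <=
    C * (\int[mu]_x `|u x|) * harmonic n.
  have V0 : 0 < n.+1%:R^-1 :> R by rewrite invr_gt0.
  have iur := integrable_test lu (test_derive1_ramp (b n) V0).
  apply: le_trans (le_normr_Rintegral _ iur) _ => //.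
  rewrite mulrAC -RintegralZl//; last exact: integrable_norm iu.
  apply: le_Rintegral => //; first exact: integrable_norm iur.
    exact: (RintegrableZ measurableT _ (integrable_norm iu)).
  by move=> x _; rewrite normrM mulrC ler_wpM2r// [leRHS]mulrC ramp'_le.
apply: norm_cvg0.
apply: (@squeeze_cvgr _ _ _ _ (fun=> 0)
  (fun n => C * (\int[mu]_x `|u x|) * harmonic n)).
- by apply: nearW => n; rewrite normr_ge0 le_harmonic.
- exact: cvg_cst.
rewrite -[X in _ --> X](mulr0 (C * \int[mu]_x `|u x|)).
by apply: cvgM; [exact: cvg_cst|exact: cvg_harmonic].
Qed.

Lemma ramp_cvg a x :
  ramp n.+1%:R a x @[n --> \oo] --> (\1_(`]a, +oo[%classic) x : R).
Proof.
apply: cvg_near_cst; rewrite indicE; have [xa|ax] := leP x a.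
  rewrite memNset/=; last by rewrite in_itv/= andbT ltNge xa.
  by apply: nearW => n; rewrite ramp0.
rewrite mem_set/=; last by rewrite in_itv/= ax.
have xa0 : 0 < x - a by rewrite subr_gt0.
near=> n; rewrite ramp1//.
suff : `|0 - harmonic n| < x - a.
  by rewrite sub0r normrN (ger0_norm (harmonic_ge0 n)) -lerBrDl => /ltW.
by near: n; move/cvgrPdist_lt: (@cvg_harmonic R); exact.
Unshelve. all: by end_near. Qed.

Lemma weak_derivative_lim f g (D : set R) (psi : nat -> R -> R)
    (chi : R -> R) l :
  weak_derivative f g -> measurable D -> measurable_fun setT g ->
  mu.-integrable D (EFin \o g) -> (forall n, test_function (psi n)) ->
  (forall n x, `|psi n x| <= \1_D x) ->
  (forall x, psi ^~ x @ \oo --> chi x) ->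
  \int[mu]_x (f x * (psi n)^`() x) @[n --> \oo] --> l ->
  \int[mu]_x (g x * chi x) = - l.
Proof.
move=> fg mD mg ig tpsi psi_le psi_chi psi'_l.
have fgpsi : (fun n => \int[mu]_x (f x * (psi n)^`() x)) =
    fun n => - \int[mu]_x (g x * psi n x).
  by apply/funext => n; exact: fg.
rewrite fgpsi in psi'_l; apply: oppr_inj; rewrite opprK.
apply: (cvg_unique (@Rhausdorff _) _ psi'_l); apply: cvgN.
apply: (@cvg_dominated_Rintegral _ setT measurableT _ _
  (fun x => `|g x| * \1_D x)) => //.
- move=> n; apply: measurable_funM => //.
  exact: continuous_measurable_fun (smooth_continuous (test_smooth (tpsi n))).
- by move=> x _; apply: cvgM; [exact: cvg_cst|exact: psi_chi].
- exact/integrable_mul_indic/integrable_norm.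
- by move=> n x _; rewrite normrM ler_wpM2l.
Qed.

Let derive1_rampB_split f k l a b : 0 < k -> 0 < l -> locint f ->
  \int[mu]_x (f x * (fun x => ramp k a x - ramp l b x)^`() x) =
  \int[mu]_x (f x * (ramp k a)^`() x) - \int[mu]_x (f x * (ramp l b)^`() x).
Proof.
move=> k0 l0 lf.
rewrite -RintegralB//; do ?exact: integrable_test lf (test_derive1_ramp _ _).
apply: eq_Rintegral => x _; rewrite -mulrBr; congr (_ * _).
have dk := smooth_is_derive x (@smooth_ramp R k a).
have dl := smooth_is_derive x (@smooth_ramp R l b).
by have [_ <-] := is_derive1D dk (is_derive1N dl); rewrite derive1E.
Qed.

Let rampB_le1 k l a b x : `|ramp k a x - ramp l b x| <= 1 :> R.
Proof.
have := ramp_ge0 k a x; have := ramp_ge0 l b x.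
have := ramp_le1 k a x; have := ramp_le1 l b x.
by rewrite ler_norml; lra.
Qed.

Lemma weak_derivative_increment f g a b : locint f -> locint g ->
  weak_derivative f g -> a <= b -> lebesgue_pt f a -> lebesgue_pt f b ->
  \int[mu]_(x in `[a, b]) g x = f b - f a.
Proof.
move=> lf lg fg ab fa fb.
have iabg : mu.-integrable `]a, b] (EFin \o g).
  by apply: integrableS (locally_integrable_itv a b lg) => //;
    exact: subset_itv_oc_cc.
rewrite -Rintegral_itv_obnd_cbnd// -Rintegral_mul_indic -opprB.
pose psi n x : R := ramp n.+1%:R a x - ramp n.+1%:R b x.
apply: (@weak_derivative_lim f g `[a, b + 1] psi) => //.
- exact: locally_integrable_measurable.
- exact: locally_integrable_itv.
- by move=> n; exact: test_rampB.
- move=> n x; rewrite indicE; have [_|] := boolP (x \in `[a, b + 1]%classic).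
    exact: rampB_le1.
  rewrite notin_setE/= in_itv/= => /negP; rewrite negb_and -!ltNge /psi.
  have V1 : n.+1%:R^-1 <= 1 :> R by rewrite invf_le1// ler1n.
  move: (n.+1%:R : R) (ltr0Sn R n) V1 => k k0 V1 /orP[xa|bx].
    by rewrite !ramp0 ?subrr ?normr0//; lra.
  by rewrite !ramp1 ?subrr ?normr0//; lra.
- move=> x; have -> : \1_(`]a, b]%classic) x =
      \1_(`]a, +oo[%classic) x - \1_(`]b, +oo[%classic) x :> R.
    rewrite !indicE !mem_setE !in_itv/= !andbT.
    by have [bx|xb] := ltP b x;
      rewrite ?andbT ?andbF ?subr0 // (le_lt_trans ab bx) subrr.
  by apply: cvgB; exact: ramp_cvg.
- under eq_fun do rewrite derive1_rampB_split//.
  by apply: cvgB; exact: derive1_ramp_cvg.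
Qed.

Lemma Rintegral_weak_derivative_gt u v a :
  mu.-integrable setT (EFin \o u) -> mu.-integrable setT (EFin \o v) ->
  weak_derivative u v -> lebesgue_pt u a ->
  \int[mu]_(x in `]a, +oo[) v x = - u a.
Proof.
move=> iu iv uv ua; have lu := open_integrable_locally openT iu.
pose psi n x : R := ramp n.+1%:R a x - ramp n.+1%:R^-1 n.+1%:R x.
rewrite -Rintegral_mul_indic -[u a]subr0.
apply: (@weak_derivative_lim u v setT psi) => //.
- by apply/measurable_EFinP; exact: measurable_int iv.
- by move=> n; apply: test_rampB; rewrite ?invr_gt0.
- by move=> n x; rewrite indicT; exact: rampB_le1.
- move=> x; rewrite -[X in _ --> X]subr0; apply: cvgB; first exact: ramp_cvg.
  apply: cvg_near_cst; near=> n; rewrite ramp0 ?invr_gt0//.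
  by rewrite (@le_trans _ _ n%:R) ?ler_nat//; near: n; exact: nbhs_infty_ger.
- under eq_fun do rewrite derive1_rampB_split ?invr_gt0//.
  by apply: cvgB; [exact: derive1_ramp_cvg|exact: derive1_flat_ramp_cvg0].
Unshelve. all: by end_near. Qed.

Lemma Rintegral_weak_derivative_le u v a :
  mu.-integrable setT (EFin \o u) -> mu.-integrable setT (EFin \o v) ->
  weak_derivative u v -> lebesgue_pt u a ->
  \int[mu]_(x in `]-oo, a]) v x = u a.
Proof.
move=> iu iv uv ua; have lu := open_integrable_locally openT iu.
pose psi n x : R := ramp n.+1%:R^-1 (- (2 * n.+1%:R)) x - ramp n.+1%:R a x.
rewrite -Rintegral_mul_indic -[u a]opprK -[- u a]sub0r.
apply: (@weak_derivative_lim u v setT psi) => //.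
- by apply/measurable_EFinP; exact: measurable_int iv.
- by move=> n; apply: test_rampB; rewrite ?invr_gt0.
- by move=> n x; rewrite indicT; exact: rampB_le1.
- move=> x.
  have -> : \1_(`]-oo, a]%classic) x = 1 - \1_(`]a, +oo[%classic) x :> R.
    by rewrite !indicE !mem_setE !in_itv/= andbT leNgt; case: ltP;
      rewrite ?subrr ?subr0.
  apply: cvgB; last exact: ramp_cvg.
  apply: cvg_near_cst; near=> n; rewrite ramp1 ?invr_gt0// invrK.
  have : - x <= n%:R by near: n; exact: nbhs_infty_ger.
  by rewrite -natr1; lra.
- under eq_fun do rewrite derive1_rampB_split ?invr_gt0//.
  by apply: cvgB; [exact: derive1_flat_ramp_cvg0|exact: derive1_ramp_cvg].
Unshelve. all: by end_near. Qed.

Lemma Rintegral_derive1_test_gt psi a : test_function psi ->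
  \int[mu]_(x in `]a, +oo[) psi^`() x = - psi a.
Proof.
move=> tpsi; have spsi := test_smooth tpsi.
apply: Rintegral_weak_derivative_gt; [exact: test_integrable| | |].
- exact/test_integrable/test_derive1.
- exact: weak_derivative_smooth.
- exact/lebesgue_pt_continuous/smooth_continuous.
Qed.

Lemma fundamental_lemma_variations f : locint f ->
  (forall psi, test_function psi -> \int[mu]_x (f x * psi x) = 0) ->
  {ae mu, forall x, f x = 0}.
Proof.
move=> lf f0; apply: ae_imp (lebesgue_differentiation lf) => a fa.
apply: (cvg_unique (@Rhausdorff _) (derive1_ramp_cvg lf fa)).
have -> : (fun n => \int[mu]_x (f x * (ramp n.+1%:R a)^`() x)) = fun=> 0.
  by apply/funext => n; exact/f0/test_derive1_ramp.
exact: cvg_cst.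
Qed.

Lemma weak_derivative_unique f g1 g2 : locint g1 -> locint g2 ->
  weak_derivative f g1 -> weak_derivative f g2 ->
  {ae mu, forall x, g1 x = g2 x}.
Proof.
move=> lg1 lg2 fg1 fg2.
have lg12 : locint (fun x => g1 x - g2 x) by exact: locally_integrableB.
apply: ae_imp (fundamental_lemma_variations lg12 _) => [x /eqP|psi tpsi].
  by rewrite subr_eq0 => /eqP.
under eq_Rintegral do rewrite mulrBl.
rewrite RintegralB//; do ?exact: integrable_test.
by have := fg1 psi tpsi; rewrite fg2// => /oppr_inj ->; rewrite subrr.
Qed.

End weak_derivative.

Section primitive.
Variable R : realType.
Local Notation mu := (@lebesgue_measure R).
Local Notation locint := (locally_integrable [set: R]).
Implicit Types (f g u v : R -> R) (a b c x : R).

Definition primitive g x : R :=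
  if 0 <= x then \int[mu]_(t in `[0, x]) g t else - \int[mu]_(t in `[x, 0]) g t.

Lemma primitiveB g a b : locint g -> a <= b ->
  primitive g b - primitive g a = \int[mu]_(t in `[a, b]) g t.
Proof.
move=> lg ab; rewrite /primitive; have [a0|a0] := leP 0 a.
  by rewrite (le_trans a0 ab) (Rintegral_itv_cat lg a0 ab) addrAC subrr add0r.
have [b0|b0] := leP 0 b.
  by rewrite opprK addrC (Rintegral_itv_cat lg (ltW a0) b0).
by rewrite (Rintegral_itv_cat lg ab (ltW b0)) opprK addrC addrK.
Qed.

Let primitive_near g a x : locint g -> a < x ->
  \forall y \near x,
    primitive g a + \int[mu]_(t in `[a, y]) g t = primitive g y.
Proof.
move=> lg ax; near=> y; rewrite -primitiveB// ?subrKC//.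
by near: y; apply: filterS (lt_nbhsr ax) => z /ltW.
Unshelve. all: by end_near. Qed.

Lemma primitive_continuous g : locint g -> continuous (primitive g).
Proof.
move=> lg x; have x1 : x - 1 < x by rewrite ltrBlDr ltrDl.
have cint : {for x, continuous (fun y => \int[mu]_(t in `[x - 1, y]) g t)}.
  have itv2 : x - 1 <= x + 1 by lra.
  have := parameterized_integral_continuous itv2
    (locally_integrable_itv (x - 1) (x + 1) lg).
  by move=> /within_continuous_continuous; apply; [lra|rewrite in_itv/=; lra].
have cadd : {for x, continuous
    (fun y => primitive g (x - 1) + \int[mu]_(t in `[x - 1, y]) g t)}.
  by apply: (@continuousD _ _ _ (cst _)) => //; exact: cvg_cst.
have primE := primitive_near lg x1.
rewrite /continuous_at -(nbhs_singleton primE).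
by apply: cvg_trans cadd; exact: near_eq_cvg.
Qed.

Lemma is_derive_primitive g x : locint g -> {for x, continuous g} ->
  is_derive x 1 (primitive g) (g x).
Proof.
move=> lg cg; have x1 : x - 1 < x by lra.
have x2 : x < x + 1 by lra.
have := continuous_FTC1_closed x2
  (locally_integrable_itv (x - 1) (x + 1) lg) x1 cg.
rewrite derive1E => -[dint vint].
apply: (near_eq_is_derive (primitive_near lg x1)).
apply: (is_derive_eq (is_derive1D (is_derive_cst (primitive g (x - 1)) x 1)
  (DeriveDef dint vint))).
by rewrite add0r.
Qed.

Lemma ae_eq_primitive f g : measurable_fun setT f -> measurable_fun setT g ->
  {ae mu, forall x, f x = g x} -> primitive f = primitive g.
Proof.
move=> mf mg fg.
suff eq_itv a b : \int[mu]_(x in `[a, b]) f x = \int[mu]_(x in `[a, b]) g x.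
  by apply/funext => x; rewrite /primitive !eq_itv.
rewrite -[LHS]Rintegral_mul_indic -[RHS]Rintegral_mul_indic;
  apply: ae_eq_Rintegral; do ?exact: measurable_funM.
by apply: ae_imp fg => x ->.
Qed.

Lemma weak_derivative_primitive f g : locint f -> locint g ->
  weak_derivative f g -> exists c, {ae mu, forall x, f x = c + primitive g x}.
Proof.
move=> lf lg fg; have pts := lebesgue_differentiation lf.
have [a _ fa] := ae_itv_exists ltr01 pts.
exists (f a - primitive g a); apply: ae_imp pts => x fx.
have [ax|/ltW xa] := leP a x.
  by have := weak_derivative_increment lf lg fg ax fa fx; rewrite -primitiveB//;
    lra.
by have := weak_derivative_increment lf lg fg xa fx fa; rewrite -primitiveB//;
  lra.
Qed.

Lemma is_derive_weak_derivative u v f x : continuous u -> locint v ->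
  locint f -> weak_derivative u v -> {ae mu, forall y, v y = f y} ->
  {for x, continuous f} -> is_derive x 1 u (f x).
Proof.
move=> cu lv lf uv vf cf.
have [c uE] :=
  weak_derivative_primitive (continuous_locally_integrable cu) lv uv.
have -> : u = fun y => c + primitive f y.
  rewrite -(ae_eq_primitive _ _ vf); do ?exact: locally_integrable_measurable.
  apply: (ae_eq_continuous cu _ uE).
  by apply: continuous_add; [exact: continuous_cst|exact: primitive_continuous].
apply: (is_derive_eq (is_derive1D (is_derive_cst c x 1)
  (is_derive_primitive lf cf))).
by rewrite add0r.
Qed.

End primitive.

(** * Square-integrable functions *)

Section square_integrable.
Variable R : realType.
Local Notation mu := (@lebesgue_measure R).
Local Notation locint := (locally_integrable [set: R]).
Implicit Types (f g psi : R -> R) (a b c x : R).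

Definition L2 f :=
  measurable_fun setT f /\ mu.-integrable setT (EFin \o (fun x => f x ^+ 2)).

Lemma norm_mul_le_sqrD a b : `|a * b| <= a ^+ 2 + b ^+ 2.
Proof.
have := sqr_ge0 (a - b); have := sqr_ge0 (a + b).
have := sqr_ge0 a; have := sqr_ge0 b.
by rewrite ler_norml !sqrrD sqrrN mulrN; lra.
Qed.

Lemma L2M f g : L2 f -> L2 g ->
  mu.-integrable setT (EFin \o (fun x => f x * g x)).
Proof.
move=> [mf f2] [mg g2];
  apply: (le_Rintegrable _ _ _ (RintegrableD _ f2 g2)) => //.
  exact: measurable_funM.
by move=> x _; exact: norm_mul_le_sqrD.
Qed.

Lemma L2Z c f : L2 f -> L2 (fun x => c * f x).
Proof.
move=> [mf f2]; split; first exact: measurable_funM.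
by have := RintegrableZ measurableT (c ^+ 2) f2;
  under eq_fun do rewrite -exprMn.
Qed.

Lemma L2D f g : L2 f -> L2 g -> L2 (fun x => f x + g x).
Proof.
move=> Lf Lg; have [[mf f2] [mg g2]] := (Lf, Lg); split;
  first exact: measurable_funD.
have := RintegrableD measurableT (RintegrableD measurableT f2 g2)
  (RintegrableZ measurableT 2 (L2M Lf Lg)).
by apply: eq_integrable => // x _ /=; congr EFin; ring.
Qed.

Lemma L2_locally_integrable f : L2 f -> locint f.
Proof.
move=> [mf f2]; apply: locally_integrable_of_itv => // M.
have i1 : mu.-integrable `[- M, M] (EFin \o (fun=> 1 : R)).
  exact/locally_integrable_itv/continuous_locally_integrable/continuous_cst.
have i2 : mu.-integrable `[- M, M] (EFin \o (fun x => f x ^+ 2))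
  by exact: integrableS f2.
apply: (le_Rintegrable _ _ _ (RintegrableD _ i2 i1)) => //;
  first exact: measurable_funS mf.
by move=> x _; have := norm_mul_le_sqrD (f x) 1; rewrite mulr1 expr1n.
Qed.

Lemma ae_eq_L2 f g : measurable_fun setT g -> {ae mu, forall x, f x = g x} ->
  L2 f -> L2 g.
Proof.
move=> mg fg [mf f2]; split=> //; apply: ae_eq_integrable f2;
  first exact: measurable_funX.
by apply: ae_imp fg => x ->.
Qed.

Lemma L2_test psi : test_function psi -> L2 psi.
Proof.
move=> tpsi; have cpsi := smooth_continuous (test_smooth tpsi).
split; first exact: continuous_measurable_fun.
exact: integrable_test (continuous_locally_integrable cpsi) tpsi.
Qed.

End square_integrable.

(** * Gluing at the origin *)

Section glue.
Variable R : realType.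
Local Notation mu := (@lebesgue_measure R).
Implicit Types (f g h w F G : R -> R) (x : R).

Definition glue f g x : R := if 0 < x then f x else g x.

Lemma glueE f g :
  glue f g = fun x =>
    f x * \1_(`]0, +oo[%classic) x + g x * \1_(`]-oo, 0]%classic) x.
Proof.
apply/funext => x; rewrite /glue !indicE !mem_setE !in_itv/= andbT.
by case: ltP => _; rewrite ?mulr1 ?mulr0 ?addr0 ?add0r.
Qed.

Lemma Rintegral_glue F G :
  mu.-integrable setT (EFin \o F) -> mu.-integrable setT (EFin \o G) ->
  \int[mu]_x glue F G x =
  \int[mu]_(x in `]0, +oo[) F x + \int[mu]_(x in `]-oo, 0]) G x.
Proof.
move=> iF iG; rewrite glueE RintegralD ?Rintegral_mul_indic//.
- by apply: integrable_mul_indic => //; exact: integrableS iF.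
- by apply: integrable_mul_indic => //; exact: integrableS iG.
Qed.

Lemma L2_glue f g : L2 f -> L2 g -> L2 (glue f g).
Proof.
move=> [mf f2] [mg g2].
have mglue : measurable_fun setT (glue f g).
  rewrite glueE; apply: measurable_funD; apply: measurable_funM => //;
    exact: measurable_indic.
split=> //; apply: (le_Rintegrable _ _ _ (RintegrableD _ f2 g2)) => //.
  exact: measurable_funX.
by move=> x _; rewrite ger0_norm ?sqr_ge0// /glue; case: ifP;
  rewrite ?lerDl ?lerDr sqr_ge0.
Qed.

Lemma continuous_glue f g : continuous f -> continuous g -> f 0 = g 0 ->
  continuous (glue f g).
Proof.
move=> cf cg fg0 x.
have -> : glue f g = fun y => f (Num.max y 0) + g (Num.min y 0) - f 0.
  apply/funext => y; rewrite /glue /Num.max /Num.min.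
  by case: (ltgtP y 0) => [_|_|->]; rewrite fg0; ring.
have cmax : continuous (fun y : R => Num.max y 0).
  by move=> y; apply: continuous_max; [exact: cvg_id|exact: cvg_cst].
have cmin : continuous (fun y : R => Num.min y 0).
  by move=> y; apply: continuous_min; [exact: cvg_id|exact: cvg_cst].
apply: continuous_add (@continuous_cst _ _) _ => {}x;
  apply: continuous_add => {}x.
  exact: (continuous_comp (cmax x) (cf _)).
exact: (continuous_comp (cmin x) (cg _)).
Qed.

Lemma near_glue_gt f g x : 0 < x -> \forall y \near x, f y = glue f g y.
Proof. by move=> x0; near=> y; rewrite /glue ifT//; near: y; exact: lt_nbhsr.
Unshelve. all: by end_near. Qed.

Lemma near_glue_lt f g x : x < 0 -> \forall y \near x, g y = glue f g y.
Proof.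
move=> x0; near=> y; rewrite /glue ltNge ifN// negbK.
near: y; exact: lt_le_nbhsl.
Unshelve. all: by end_near. Qed.

Lemma is_derive_glue f g F G x : x != 0 ->
  is_derive x 1 f (F x) -> is_derive x 1 g (G x) ->
  is_derive x 1 (glue f g) (glue F G x).
Proof.
rewrite neq_lt => /orP[x0|x0] df dg.
  by rewrite {2}/glue ltNge (ltW x0);
    exact: near_eq_is_derive (near_glue_lt _ _ x0) dg.
by rewrite {2}/glue x0; exact: near_eq_is_derive (near_glue_gt _ _ x0) df.
Qed.

Lemma locally_integrable_glue f g : continuous f -> continuous g ->
  locally_integrable setT (glue f g).
Proof.
move=> cf cg; rewrite glueE;
  under eq_fun do rewrite [f _ * _]mulrC [g _ * _]mulrC.
apply: locally_integrableD; apply: locally_integrableM => //;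
  by apply: locally_integrable_indic => //; exact: openT.
Qed.

(* The distributional derivative of [glue f g] is the pointwise one plus the
   jump [f 0 - g 0] at the origin, and may be tested against [h] in H^1. *)
Lemma glue_by_parts f g h w : smooth f -> smooth g -> continuous h ->
  L2 f -> L2 f^`() -> L2 g -> L2 g^`() -> L2 h -> L2 w -> weak_derivative h w ->
  \int[mu]_x (h x * glue f^`() g^`() x + w x * glue f g x) = (g 0 - f 0) * h 0.
Proof.
move=> sf sg ch Lf Lf' Lg Lg' Lh Lw hw.
have h0 F : smooth F -> lebesgue_pt (fun x => h x * F x) 0.
  by move=> sF;
    exact: lebesgue_pt_continuous (continuous_mul ch (smooth_continuous sF)).
have parts F : smooth F -> L2 F -> L2 F^`() -> [/\
    weak_derivative (fun x => h x * F x) (fun x => h x * F^`() x + w x * F x),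
    mu.-integrable setT (EFin \o (fun x => h x * F x)) &
    mu.-integrable setT (EFin \o (fun x => h x * F^`() x + w x * F x))].
  move=> sF LF LF'; split; [|exact: L2M|].
    by apply: weak_derivativeM => //; exact: L2_locally_integrable.
  by apply: RintegrableD => //; exact: L2M.
have [wf iuf ivf] := parts f sf Lf Lf'; have [wg iug ivg] := parts g sg Lg Lg'.
transitivity (\int[mu]_x glue (fun x => h x * f^`() x + w x * f x)
                              (fun x => h x * g^`() x + w x * g x) x).
  by apply: eq_Rintegral => x _; rewrite /glue; case: ifP.
rewrite Rintegral_glue// (Rintegral_weak_derivative_gt iuf ivf wf (h0 f sf)).
by rewrite (Rintegral_weak_derivative_le iug ivg wg (h0 g sg)); ring.
Qed.

End glue.

(** * The Gausson profile *)

Section gaussian.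
Variable R : realType.
Local Notation mu := (@lebesgue_measure R).
Implicit Types (a x : R) (n : nat).

Definition gaussian a x : R := expR (- (1 / 2) * (x + a) ^+ 2).

Lemma gaussian_gt0 a x : 0 < gaussian a x. Proof. exact: expR_gt0. Qed.

Lemma gaussian_sqr a x : gaussian a x ^+ 2 = expR (- (x + a) ^+ 2).
Proof. by rewrite /gaussian -expRM_natl; congr expR; lra. Qed.

Lemma is_derive_gaussian a x :
  is_derive x 1 (gaussian a) (- (x + a) * gaussian a x).
Proof.
have dsq := is_derive1X 2 (is_derive_addr x a).
have dexp := is_derive1_comp (is_derive_expR _)
  (is_derive1M (is_derive_cst (- (1 / 2) : R) x 1) dsq).
by apply: (is_derive_eq dexp); rewrite /gaussian /= ; field.
Qed.

Lemma derive1_gaussian a : (gaussian a)^`() = fun x => - (x + a) * gaussian a x.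
Proof. by apply: is_derive_derive1 => x; exact: is_derive_gaussian. Qed.

Lemma derive1_derive1_gaussian a :
  (gaussian a)^`()^`() = fun x => ((x + a) ^+ 2 - 1) * gaussian a x.
Proof.
rewrite derive1_gaussian; apply: is_derive_derive1 => x.
apply: (is_derive_eq (is_derive1M (is_derive1N (is_derive_addr x a))
  (is_derive_gaussian a x))).
by ring.
Qed.

Lemma smooth_gaussian a : smooth (gaussian a).
Proof.
have sadd : smooth (fun x => x + a).
  by apply: smooth_add; [exact: smooth_id|exact: smooth_cst].
apply: (@smooth_comp _ (@expR R) (fun x => - (1 / 2) * (x + a) ^+ 2));
  first exact: smooth_expR.
by apply: smooth_mul; [exact: smooth_cst|exact: (smooth_mul sadd sadd)].
Qed.

Lemma integrable_gaussian a : mu.-integrable setT (EFin \o gaussian a).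
Proof.
have peak0 : normal_peak (1 : R) != 0.
  by rewrite gt_eqF// normal_peak_gt0 ?oner_eq0.
have := RintegrableZ measurableT (normal_peak 1)^-1
  (@integrable_normal_pdf R (- a) 1).
apply: eq_integrable => // x _ /=; rewrite normal_pdfE ?oner_eq0//; congr EFin.
rewrite -[X in _ * X]/(normal_peak 1 * normal_fun (- a) 1 x) mulKf//.
by rewrite /normal_fun /gaussian opprK expr1n; congr expR; field.
Qed.

Lemma L2_expn_gaussian n a : L2 (fun x => (x + a) ^+ n * gaussian a x).
Proof.
have mf : measurable_fun setT (fun x : R => (x + a) ^+ n * gaussian a x).
  apply: measurable_funM.
    by apply: measurable_funX; exact: measurable_funD.
  exact: continuous_measurable_fun (smooth_continuous (@smooth_gaussian a)).
split=> //.
have := RintegrableZ measurableT (2 ^+ n * n`!%:R) (integrable_gaussian a).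
apply: le_Rintegrable => //; first exact: measurable_funX.
move=> x _; rewrite ger0_norm ?sqr_ge0// exprMn gaussian_sqr -exprM.
rewrite mulnC exprM /gaussian.
move: ((x + a) ^+ 2) (sqr_ge0 (x + a)) => y y0.
have y20 : 0 <= y / 2 by rewrite divr_ge0.
have -> : - y = - (1 / 2) * y - y / 2 by lra.
rewrite expRD mulrA mulrAC ler_wpM2r ?expR_ge0// expRN ler_pdivrMr ?expR_gt0//.
have := expn_le_fact_expR n y20.
by rewrite expr_div_n ler_pdivrMr ?exprn_gt0// mulrC mulrA.
Qed.

End gaussian.

Section gausson.
Variables (R : realType) (a : R).
Local Notation mu := (@lebesgue_measure R).
Implicit Types (h w : R -> R) (x : R).

Definition gausson := glue (gaussian a) (gaussian (- a)).
Definition gausson1 := glue (gaussian a)^`() (gaussian (- a))^`().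
Definition gausson2 := glue (gaussian a)^`()^`() (gaussian (- a))^`()^`().

Lemma gaussonE x : gausson x = gaussian a `|x|.
Proof.
rewrite /gausson /glue; case: ltP => x0; first by rewrite gtr0_norm.
by rewrite ler0_norm// /gaussian -sqrrN opprD opprK.
Qed.

Lemma gausson_gt0 x : 0 < gausson x.
Proof. by rewrite gaussonE gaussian_gt0. Qed.

Lemma ln_gausson_sqr x : ln (gausson x ^+ 2) = - (`|x| + a) ^+ 2.
Proof. by rewrite gaussonE gaussian_sqr expRK. Qed.

Lemma gausson_ode x : gausson2 x = - (1 + ln (gausson x ^+ 2)) * gausson x.
Proof.
rewrite ln_gausson_sqr /gausson2 /gausson /glue !derive1_derive1_gaussian.
case: ltP => x0; first by rewrite gtr0_norm//; ring.
by rewrite ler0_norm//; ring.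
Qed.

Lemma gausson_continuous : continuous gausson.
Proof.
apply: continuous_glue; do ?exact/smooth_continuous/smooth_gaussian.
by rewrite /gaussian !add0r sqrrN.
Qed.

Let L2_gaussian b : L2 (@gaussian R b).
Proof. by have := L2_expn_gaussian 0 b; under eq_fun do rewrite mul1r. Qed.

Let L2_gaussian1 b : L2 (@gaussian R b)^`().
Proof.
rewrite derive1_gaussian; have := L2Z (-1) (L2_expn_gaussian 1 b).
by under eq_fun do rewrite mulrA mulN1r.
Qed.

Let L2_gaussian2 b : L2 (@gaussian R b)^`()^`().
Proof.
rewrite derive1_derive1_gaussian;
  have := L2D (L2_expn_gaussian 2 b) (L2Z (-1) (L2_gaussian b)).
by under eq_fun do rewrite -mulrDl.
Qed.

Lemma L2_gausson : L2 gausson.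
Proof. exact: L2_glue (L2_gaussian _) (L2_gaussian _). Qed.

Lemma L2_gausson1 : L2 gausson1.
Proof. exact: L2_glue (L2_gaussian1 _) (L2_gaussian1 _). Qed.

Lemma L2_gausson2 : L2 gausson2.
Proof. exact: L2_glue (L2_gaussian2 _) (L2_gaussian2 _). Qed.

Lemma weak_derivative_gausson : weak_derivative gausson gausson1.
Proof.
move=> psi tpsi; have spsi := test_smooth tpsi; have tpsi' := test_derive1 tpsi.
have := glue_by_parts (@smooth_gaussian R a) (@smooth_gaussian R (- a))
  (smooth_continuous spsi) (L2_gaussian _) (L2_gaussian1 _)
  (L2_gaussian _) (L2_gaussian1 _)
  (L2_test tpsi) (L2_test tpsi') (weak_derivative_smooth spsi).
rewrite RintegralD//;
  [|exact: L2M (L2_test tpsi) L2_gausson1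
   |exact: L2M (L2_test tpsi') L2_gausson].
have -> : gaussian (- a) 0 - gaussian a 0 = 0 :> R.
  by rewrite /gaussian !add0r sqrrN subrr.
rewrite mul0r addrC => /eqP; rewrite addr_eq0 => /eqP.
by under eq_Rintegral do rewrite mulrC; move=> ->; congr (- _);
  apply: eq_Rintegral => x _; rewrite mulrC.
Qed.

Lemma gausson_by_parts h w : continuous h -> L2 h -> L2 w ->
  weak_derivative h w ->
  \int[mu]_x (h x * gausson2 x + w x * gausson1 x) = 2 * a * gausson 0 * h 0.
Proof.
move=> ch Lh Lw hw.
rewrite (glue_by_parts _ _ ch _ _ _ _ Lh Lw hw)//;
  do ?exact/smooth_derive1/smooth_gaussian.
by rewrite !derive1_gaussian /gausson /glue ltxx /gaussian !add0r sqrrN; ring.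
Qed.

End gausson.

(** * The logarithmic equation on an interval *)

Section normsq.
Variable R : realType.
Implicit Types (p q : R -> R) (a b x y t N : R).

Lemma sqrD_eq0 a b : a ^+ 2 + b ^+ 2 = 0 -> a = 0 /\ b = 0.
Proof.
by move/eqP; rewrite paddr_eq0 ?sqr_ge0// !sqrf_eq0 => /andP[/eqP-> /eqP->].
Qed.

Definition normsq p q x : R := p x ^+ 2 + q x ^+ 2.

Lemma normsq_ge0 p q x : 0 <= normsq p q x.
Proof. by rewrite addr_ge0 ?sqr_ge0. Qed.

Lemma normsqC p q x : normsq p q x = normsq q p x. Proof. exact: addrC. Qed.

Lemma normsq_gt0 p q x : (0 < normsq p q x) = (normsq p q x != 0).
Proof. by rewrite lt0r normsq_ge0 andbT. Qed.

Lemma normsq_eq0 p q x : normsq p q x = 0 -> p x = 0 /\ q x = 0.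
Proof. exact: sqrD_eq0. Qed.

Lemma continuous_normsq p q x : {for x, continuous p} ->
  {for x, continuous q} -> {for x, continuous (normsq p q)}.
Proof.
by move=> cp cq; exact: (continuousD (continuousM cp cp) (continuousM cq cq)).
Qed.

Lemma is_derive_normsq p q x a b : is_derive x 1 p a -> is_derive x 1 q b ->
  is_derive x 1 (normsq p q) (2 * (p x * a + q x * b)).
Proof.
move=> dp dq;
  apply: (is_derive_eq (is_derive1D (is_derive1X 2 dp) (is_derive1X 2 dq))).
by rewrite /=; ring.
Qed.

Lemma norm_mul_ln_le t N : t ^+ 2 <= N -> N <= 1 ->
  `|t * ln N| <= 4 * Num.sqrt (Num.sqrt N).
Proof.
move=> tN N1; have [N0|N0] := leP N 0;
  first by rewrite ln0// mulr0 normr0 mulr_ge0// sqrtr_ge0.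
set u := Num.sqrt (Num.sqrt N).
have u0 : 0 < u by rewrite !sqrtr_gt0.
have u2 : u ^+ 2 = Num.sqrt N by rewrite sqr_sqrtr// sqrtr_ge0.
have u4 : u ^+ 4 = N by rewrite (exprM u 2 2) u2 sqr_sqrtr// ltW.
have u1 : u <= 1 by rewrite -(@expr_le1 _ 4 u isT (ltW u0)) u4.
have tu : `|t| <= u ^+ 2 by rewrite u2 -sqrtr_sqr ler_wsqrtr.
have lnu : `|ln u| <= u^-1.
  rewrite ler0_norm -?ln1 ?ler_ln ?posrE// -lnV ?posrE//.
  by apply/ltW/ln_sublinear; rewrite invr_gt0.
have lnN : ln N = 4 * ln u by rewrite -u4 lnXn// mulr_natl.
rewrite lnN mulrCA normrM normr_nat ler_pM2l// normrM.
apply: le_trans (ler_pM _ _ tu lnu) _ => //.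
by rewrite expr2 mulfK// gt_eqF.
Qed.

Lemma continuous_mul_ln_normsq p q x :
  {for x, continuous p} -> {for x, continuous q} ->
  {for x, continuous (fun y => p y * ln (normsq p q y))}.
Proof.
move=> cp cq; have cN := continuous_normsq cp cq.
have [Nx0|] := eqVneq (normsq p q x) 0; last first.
  rewrite -normsq_gt0 => Nx; apply: continuousM => //.
  exact: (@continuous_comp _ _ _ (normsq p q) (@ln R) x cN (continuous_ln Nx)).
have csqrt f : {for x, continuous f} ->
  {for x, continuous (fun y => Num.sqrt (f y) : R)}.
  by move=> cf;
    exact: (@continuous_comp _ _ _ f Num.sqrt x cf (@sqrt_continuous R _)).
have [px0 _] := normsq_eq0 Nx0.
rewrite /prop_for /continuous_at px0 mul0r; apply: norm_cvg0.
apply: (@squeeze_cvgr _ _ _ _ (fun=> 0)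
  (fun y => 4 * Num.sqrt (Num.sqrt (normsq p q y)))).
- have Nx1 : normsq p q x < 1 by rewrite Nx0.
  near=> y; rewrite normr_ge0 norm_mul_ln_le ?lerDl ?sqr_ge0//.
  by near: y; exact: cN _ (lt_le_nbhsl Nx1).
- exact: cvg_cst.
- have : {for x, continuous (fun y => 4 * Num.sqrt (Num.sqrt (normsq p q y)))}.
    by apply: continuousM; [exact: cvg_cst|exact/csqrt/csqrt].
  by rewrite /prop_for /continuous_at Nx0 !sqrtr0 mulr0.
Unshelve. all: by end_near. Qed.

(* Where [normsq p q] vanishes, the product with [ln] is differentiable because
   [p] and [q] vanish there. *)
Lemma is_derive_mul_ln_normsq p q x a b :
  is_derive x 1 p a -> is_derive x 1 q b ->
  is_derive x 1 (fun y => normsq p q y * ln (normsq p q y))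
    (2 * (p x * a + q x * b) * (ln (normsq p q x) + 1)).
Proof.
move=> dp dq; have dN := is_derive_normsq dp dq.
have [cp cq] := (is_derive_continuous dp, is_derive_continuous dq).
have [Nx0|Nx0] := eqVneq (normsq p q x) 0; last first.
  have dln := is_derive1_comp (is_derive1_ln _) dN; rewrite -normsq_gt0 in Nx0.
  by apply: (is_derive_eq (is_derive1M dN (dln Nx0))); rewrite /=; field;
    rewrite gt_eqF.
have [px0 qx0] := normsq_eq0 Nx0.
have dpln := is_derive1M_zero px0 dp (continuous_mul_ln_normsq cp cq).
have dqln := is_derive1M_zero qx0 dq (continuous_mul_ln_normsq cq cp).
have -> : (fun y => normsq p q y * ln (normsq p q y)) =
    fun y => p y * (p y * ln (normsq p q y)) + q y * (q y * ln (normsq q p y)).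
  by apply/funext => y; rewrite [normsq q p y]normsqC {1}/normsq; ring.
by apply: (is_derive_eq (is_derive1D dpln dqln)); rewrite px0 qx0; ring.
Qed.

End normsq.

Section intervals.
Variables (R : realType) (I : set R).
Local Notation mu := (@lebesgue_measure R).
Hypotheses (openI : open I) (itvI : is_interval I).

Lemma is_interval_clopen (P : R -> Prop) : (exists2 x, I x & P x) ->
  (forall x, I x -> P x -> \forall y \near x, P y) ->
  (forall x, I x -> ~ P x -> \forall y \near x, ~ P y) ->
  forall x, I x -> P x.
Proof.
move=> [x0 Ix0 Px0] nearP nearNP; suff -> : I = I `&` P by move=> x [].
have nearI x : I x -> \forall y \near x, I y.
  by move=> Ix; exact: open_nbhs_nbhs.
apply/esym/(connected_intervalP I).2 => //; first by exists x0.
- exists (I `&` P); last by rewrite setIA setIid.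
  by rewrite openE => x [Ix Px]; apply: filterI; [exact: nearI|exact: nearP].
- exists (~` (I `&` ~` P)).
    by apply: open_closedC; rewrite openE => x [Ix NPx]; apply: filterI;
      [exact: nearI|exact: nearNP].
  by rewrite setCI setCK setIUr setICr set0U.
Qed.

Lemma integrable_derive0_eq0 (f : R -> R) : mu I = +oo%E ->
  (forall x : R, I x -> is_derive x 1 f 0) -> mu.-integrable I (EFin \o f) ->
  forall x, I x -> f x = 0.
Proof.
move=> muI df fi x Ix; apply/eqP; rewrite -normr_eq0 -[_ == _]negbK.
have mI : measurable I by exact: open_measurable.
case/integrableP: fi => _; apply: contraTN => fx0.
have -> : (\int[mu]_(y in I) `|(EFin \o f) y| =
    \int[mu]_(y in I) cst `|f x|%:E y)%E.
  by apply: eq_integral => y; rewrite inE => Iy;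
    rewrite /= (is_derive0_eq_on itvI df Iy Ix).
by rewrite integral_cst//= muI gt0_muley ?ltxx// lte_fin lt0r fx0 normr_ge0.
Qed.

End intervals.

Section log_ode.
Variable R : realType.
Local Notation mu := (@lebesgue_measure R).
Implicit Types (a x y : R).
Variables (omega : R) (p q P Q : R -> R) (I : set R).
Hypotheses (openI : open I) (itvI : is_interval I) (muI : mu I = +oo%E).

Local Notation N := (normsq p q).

Hypothesis dp : forall x, I x -> is_derive x 1 p (P x).
Hypothesis dq : forall x, I x -> is_derive x 1 q (Q x).
Hypothesis dP : forall x, I x -> is_derive x 1 P ((omega - ln (N x)) * p x).
Hypothesis dQ : forall x, I x -> is_derive x 1 Q ((omega - ln (N x)) * q x).
Hypothesis iN : mu.-integrable I (EFin \o N).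
Hypothesis iNln : mu.-integrable I (EFin \o (fun x => N x * ln (N x))).
Hypothesis iPQ : mu.-integrable I (EFin \o normsq P Q).

Let mI : measurable I. Proof. exact: open_measurable. Qed.

Let cont x : I x -> [/\ {for x, continuous p}, {for x, continuous q},
  {for x, continuous P} & {for x, continuous Q}].
Proof.
by move=> Ix; split; [move: (dp Ix)|move: (dq Ix)|move: (dP Ix)|move: (dQ Ix)];
  exact: is_derive_continuous.
Qed.

Let energy x := normsq P Q x - (omega + 1) * N x + N x * ln (N x).

Let wronskian x := p x * Q x - q x * P x.

Lemma energy_eq0 x : I x ->
  normsq P Q x - (omega + 1) * N x + N x * ln (N x) = 0.
Proof.
apply: (@integrable_derive0_eq0 _ _ openI itvI energy muI) => [y Iy|].
  have dN := is_derive_normsq (dp Iy) (dq Iy).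
  have dPQ := is_derive_normsq (dP Iy) (dQ Iy).
  have dcN := is_derive1M (is_derive_cst (omega + 1) y 1) dN.
  have dNln := is_derive_mul_ln_normsq (dp Iy) (dq Iy).
  by apply: (is_derive_eq (is_derive1D (is_derive1D dPQ (is_derive1N dcN))
    dNln)); rewrite /=; ring.
by apply: RintegrableD => //; apply: RintegrableB => //; exact: RintegrableZ.
Qed.

Lemma wronskian_eq0 x : I x -> p x * Q x = q x * P x.
Proof.
move=> Ix; apply/eqP; rewrite -subr_eq0; apply/eqP; move: x Ix.
apply: (@integrable_derive0_eq0 _ _ openI itvI wronskian muI) => [y Iy|].
  have dpQ := is_derive1M (dp Iy) (dQ Iy).
  have dqP := is_derive1M (dq Iy) (dP Iy).
  by apply: (is_derive_eq (is_derive1D dpQ (is_derive1N dqP))); ring.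
apply: (le_Rintegrable _ _ _ (RintegrableD _ iN iPQ)) => //.
  apply: open_continuous_measurable_fun => // y;
    rewrite inE => /cont[cp cq cP cQ].
  exact: (continuousB (continuousM cp cQ) (continuousM cq cP)).
move=> y _; apply: le_trans (ler_normB _ _) _.
have := norm_mul_le_sqrD (p y) (Q y); have := norm_mul_le_sqrD (q y) (P y).
by rewrite /normsq; lra.
Qed.

Let slope x := (p x * P x + q x * Q x) / N x.

Let slope_mulN x : 0 < N x -> p x * P x + q x * Q x = slope x * N x.
Proof. by move=> Nx; rewrite divfK ?gt_eqF. Qed.

Let slopeE x : I x -> 0 < N x -> P x = slope x * p x /\ Q x = slope x * q x.
Proof.
move=> Ix Nx; have w := wronskian_eq0 Ix.
split; apply: (mulIf (lt0r_neq0 Nx)); rewrite mulrAC -slope_mulN// /normsq.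
  by rewrite [RHS](_ : _ = P x * p x ^+ 2 + q x * (p x * Q x)); [rewrite w|];
    ring.
by rewrite [RHS](_ : _ = Q x * q x ^+ 2 + p x * (q x * P x)); [rewrite -w|];
  ring.
Qed.

Let ln_normsqE x : I x -> 0 < N x -> ln (N x) = omega + 1 - slope x ^+ 2.
Proof.
move=> Ix Nx; apply: (mulIf (lt0r_neq0 Nx)); have [Pm Qm] := slopeE Ix Nx.
have := energy_eq0 Ix; rewrite [normsq P Q x]/normsq Pm Qm => e.
by apply/eqP; rewrite -subr_eq0 -e; apply/eqP; rewrite /normsq; ring.
Qed.

Let is_derive_slope x : I x -> 0 < N x -> is_derive x 1 slope (-1).
Proof.
move=> Ix Nx; have Nx0 := lt0r_neq0 Nx.
have dNV := is_derive1V Nx0 (is_derive_normsq (dp Ix) (dq Ix)).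
have dnum := is_derive1D (is_derive1M (dp Ix) (dP Ix))
  (is_derive1M (dq Ix) (dQ Ix)).
apply: (is_derive_eq (is_derive1M dnum dNV)); rewrite /=.
have [-> ->] := slopeE Ix Nx; rewrite ln_normsqE//; move: Nx0;
  rewrite /normsq => Nx0.
by move: (slope x) => m; field.
Qed.

Let on_gaussian a x :=
  N x = expR (omega + 1) * gaussian a x ^+ 2 /\
  p x * P x + q x * Q x = - (x + a) * N x.

Let on_gaussian_gt0 a x : on_gaussian a x -> 0 < N x.
Proof. by move=> [-> _]; rewrite mulr_gt0 ?exprn_gt0 ?expR_gt0. Qed.

Let on_gaussianP a x : I x -> 0 < N x ->
  slope x = - (x + a) <-> on_gaussian a x.
Proof.
move=> Ix Nx; split=> [mE|[_ mN]]; last by rewrite /slope mN mulfK// gt_eqF.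
split; last by rewrite slope_mulN// mE.
rewrite gaussian_sqr -expRD -[LHS]lnK ?posrE// ln_normsqE// mE sqrrN.
by congr expR; ring.
Qed.

Let near_on_gaussian a x : I x -> on_gaussian a x ->
  \forall y \near x, on_gaussian a y.
Proof.
move=> Ix gx; have Nx := on_gaussian_gt0 gx.
have [cp cq _ _] := cont Ix; have cN := continuous_normsq cp cq.
have /nbhs_ballP[e /= e0 ball_IN] : nbhs x (I `&` [set y | 0 < N y]).
  apply: filterI; first exact: open_nbhs_nbhs.
  exact: cN _ (lt_nbhsr Nx).
apply/nbhs_ballP; exists e => //= y xy; have [Iy Ny] := ball_IN _ xy.
apply/(on_gaussianP a Iy Ny).
have slopeD z t : ball x e z -> ball x e t -> slope z + z = slope t + t.
  apply: (@is_derive0_eq_on _ (ball x e) (fun s => slope s + s)) =>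
    {z t} [|z /ball_IN[Iz Nz]].
    by rewrite ball_itv; exact: interval_is_interval.
  by apply: (is_derive_eq (is_derive1D (is_derive_slope Iz Nz)
    (is_derive_id z 1))); rewrite addNr.
have := slopeD _ _ xy (ballxx x e0).
by rewrite ((on_gaussianP a Ix Nx).2 gx); lra.
Qed.

Let near_off_gaussian a x : I x -> ~ on_gaussian a x ->
  \forall y \near x, ~ on_gaussian a y.
Proof.
move=> Ix offx; have [cp cq cP cQ] := cont Ix.
have cN := continuous_normsq cp cq.
have cG : {for x, continuous (gaussian a)}
  by exact/smooth_continuous/smooth_gaussian.
have cdiff : {for x, continuous
    (fun y => N y - expR (omega + 1) * gaussian a y ^+ 2)}.
  apply: continuousB => //; apply: continuousM; first exact: cvg_cst.
  exact: (continuousM cG cG).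
have cdot : {for x, continuous
    (fun y => p y * P y + q y * Q y - (- (y + a) * N y))}.
  have cadd := is_derive_continuous (is_derive1N (is_derive_addr x a)).
  exact: (continuousB (continuousD (continuousM cp cP) (continuousM cq cQ))
    (continuousM cadd cN)).
have [diff0|diff0] := eqVneq (N x - expR (omega + 1) * gaussian a x ^+ 2) 0;
  last first.
  apply: filterS (continuous_neq_near cdiff diff0) => y diffy [/eqP].
  by rewrite -subr_eq0 (negbTE diffy).
have [dot0|dot0] := eqVneq (p x * P x + q x * Q x - (- (x + a) * N x)) 0;
  last first.
  apply: filterS (continuous_neq_near cdot dot0) => y doty [_ /eqP].
  by rewrite -subr_eq0 (negbTE doty).
by case: offx; split; apply/eqP; rewrite -subr_eq0; apply/eqP.
Qed.

Lemma log_ode_slope x0 : I x0 -> 0 < N x0 -> exists a, forall x, I x ->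
  [/\ N x = expR (omega + 1) * gaussian a x ^+ 2,
      P x = - (x + a) * p x & Q x = - (x + a) * q x].
Proof.
move=> Ix0 Nx0; pose a := - (slope x0 + x0); exists a => x Ix.
have gx0 : on_gaussian a x0 by apply/(on_gaussianP a Ix0 Nx0); rewrite /a; ring.
have gx : on_gaussian a x.
  apply: (is_interval_clopen openI itvI (P := on_gaussian a)) Ix;
    first by exists x0.
    exact: near_on_gaussian.
  exact: near_off_gaussian.
have Nx := on_gaussian_gt0 gx.
have [Pm Qm] := slopeE Ix Nx; case: (gx) => NE _.
by rewrite NE -((on_gaussianP a Ix Nx).2 gx).
Qed.

Let is_derive0_div_gaussian f f' a x :
  is_derive x 1 f f' -> f' = - (x + a) * f x ->
  is_derive x 1 (fun y => f y * (gaussian a y)^-1) 0.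
Proof.
move=> df f'E; have G0 := lt0r_neq0 (gaussian_gt0 a x).
apply: (is_derive_eq
  (is_derive1M df (is_derive1V G0 (is_derive_gaussian a x)))).
by rewrite f'E; field.
Qed.

Lemma log_ode_gaussian : exists a k1 k2,
  (k1 ^+ 2 + k2 ^+ 2 = 0 \/ k1 ^+ 2 + k2 ^+ 2 = expR (omega + 1)) /\
  forall x, I x -> [/\ p x = k1 * gaussian a x, q x = k2 * gaussian a x,
    P x = - (x + a) * p x & Q x = - (x + a) * q x].
Proof.
have [[x0 Ix0 Nx0]|N0] := pselect (exists2 x0, I x0 & N x0 != 0); last first.
  have pq0 x : I x -> p x = 0 /\ q x = 0.
    by move=> Ix; apply: normsq_eq0; apply: contrapT => /eqP Nx; apply: N0;
      exists x.
  exists 0, 0, 0; split; first by left; rewrite expr0n addr0.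
  move=> x Ix; have [-> ->] := pq0 x Ix; rewrite !mul0r !mulr0; split=> //.
    apply: is_derive_unique (dp Ix) (near_eq_is_derive _ (is_derive_cst 0 x 1)).
    by near=> y; have [] := pq0 y; first by near: y; exact: open_nbhs_nbhs.
  apply: is_derive_unique (dq Ix) (near_eq_is_derive _ (is_derive_cst 0 x 1)).
  by near=> y; have [] := pq0 y; first by near: y; exact: open_nbhs_nbhs.
rewrite -normsq_gt0 in Nx0; have [a slopeP] := log_ode_slope Ix0 Nx0.
have G0 x := lt0r_neq0 (gaussian_gt0 a x).
have dpG (x : R) : I x -> is_derive x 1 (fun y => p y * (gaussian a y)^-1) 0.
  by move=> Ix; have [_ Pm _] := slopeP x Ix;
    exact: is_derive0_div_gaussian (dp Ix) Pm.
have dqG (x : R) : I x -> is_derive x 1 (fun y => q y * (gaussian a y)^-1) 0.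
  by move=> Ix; have [_ _ Qm] := slopeP x Ix;
    exact: is_derive0_div_gaussian (dq Ix) Qm.
exists a, (p x0 / gaussian a x0), (q x0 / gaussian a x0); split.
  have [NE _ _] := slopeP x0 Ix0; right; apply: (mulIf (expf_neq0 2 (G0 x0))).
  by rewrite -NE /normsq; field.
move=> x Ix; have [_ Pm Qm] := slopeP x Ix; split=> //.
  by rewrite (is_derive0_eq_on itvI dpG Ix0 Ix) divfK.
by rewrite (is_derive0_eq_on itvI dqG Ix0 Ix) divfK.
Unshelve. all: by end_near. Qed.

End log_ode.

(** * Complex-valued functions *)

Section real_inner_product.
Variable R : realType.
Local Notation Re := complex.Re.
Local Notation Im := complex.Im.
Implicit Types (z c : R[i]) (r : R).

Definition cdot z1 z2 : R := Re (z1 * z2^*).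

Lemma cdotE z1 z2 : cdot z1 z2 = Re z1 * Re z2 + Im z1 * Im z2.
Proof. by case: z1 z2 => [a b] [c d]; rewrite /cdot /= mulrN opprK. Qed.

Lemma ReZr c r : Re (c * r%:C) = Re c * r.
Proof. by case: c => a b /=; rewrite mulr0 subr0. Qed.

Lemma ImZr c r : Im (c * r%:C) = Im c * r.
Proof. by case: c => a b /=; rewrite mulr0 add0r. Qed.

Lemma cdotZr z c r : cdot z (c * r%:C) = cdot z c * r.
Proof. by rewrite !cdotE ReZr ImZr; ring. Qed.

Lemma cdotC z1 z2 : cdot z1 z2 = cdot z2 z1.
Proof. by rewrite !cdotE; ring. Qed.

Lemma cdotZl c z r : cdot (c * r%:C) z = r * cdot c z.
Proof. by rewrite !cdotE ReZr ImZr; ring. Qed.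

Lemma cdotz1 z : cdot z 1 = Re z.
Proof. by rewrite cdotE mulr1 mulr0 addr0. Qed.

Lemma cdotzi z : cdot z (0 +i* 1) = Im z.
Proof. by rewrite cdotE mulr1 mulr0 add0r. Qed.

Lemma cabs_sqr z : cabs z ^+ 2 = Re z ^+ 2 + Im z ^+ 2.
Proof. by case: z => a b; rewrite /cabs /= sqr_sqrtr// addr_ge0 ?sqr_ge0. Qed.

Lemma cabs_sqrZ c r : cabs (c * r%:C) ^+ 2 = cabs c ^+ 2 * r ^+ 2.
Proof. by rewrite !cabs_sqr ReZr ImZr; ring. Qed.

Lemma complex_eqP z1 z2 : Re z1 = Re z2 -> Im z1 = Im z2 -> z1 = z2.
Proof. by case: z1 z2 => [a b] [c d] /= -> ->. Qed.

End real_inner_product.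

Section complex_functions.
Variable R : realType.
Local Notation mu := (@lebesgue_measure R).
Local Notation locint := (locally_integrable [set: R]).
Local Notation Re := complex.Re.
Local Notation Im := complex.Im.
Implicit Types (u v w : R -> R[i]) (f g psi : R -> R) (c : R[i]).

Definition ccontinuous u :=
  continuous (fun x => Re (u x)) /\ continuous (fun x => Im (u x)).

Lemma ccontinuous_cmeasurable u : ccontinuous u -> cmeasurable u.
Proof. by move=> [? ?]; split; exact: continuous_measurable_fun. Qed.

Let ReZ c f : (fun x => Re (c * (f x)%:C)) = fun x => Re c * f x.
Proof. by apply/funext => x; exact: ReZr. Qed.

Let ImZ c f : (fun x => Im (c * (f x)%:C)) = fun x => Im c * f x.
Proof. by apply/funext => x; exact: ImZr. Qed.

Lemma ccontinuousZ c f : continuous f -> ccontinuous (fun x => c * (f x)%:C).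
Proof.
by move=> cf; split; rewrite (ReZ, ImZ);
  exact: continuous_mul (@continuous_cst _ _) cf.
Qed.

Lemma continuous_cdotr u c : ccontinuous u ->
  continuous (fun x => cdot (u x) c).
Proof.
move=> [cr ci]; under eq_fun do rewrite cdotE.
by apply: continuous_add; apply: continuous_mul => //; exact: continuous_cst.
Qed.

Lemma cabs_sqr_normsq u x :
  cabs (u x) ^+ 2 = normsq (fun x => Re (u x)) (fun x => Im (u x)) x.
Proof. exact: cabs_sqr. Qed.

Lemma continuous_cdotr_ln u c : ccontinuous u ->
  continuous (fun x => cdot (u x) c * ln (cabs (u x) ^+ 2)).
Proof.
move=> [cr ci]; pose N := normsq (fun x => Re (u x)) (fun x => Im (u x)).
have -> : (fun x => cdot (u x) c * ln (cabs (u x) ^+ 2)) =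
    fun x => Re (u x) * ln (N x) * Re c + Im (u x) * ln (N x) * Im c.
  by apply/funext => x; rewrite cdotE cabs_sqr_normsq -/N; ring.
apply: continuous_add; apply: continuous_mul; do ?exact: continuous_cst.
  by move=> x; exact: continuous_mul_ln_normsq (cr x) (ci x).
rewrite /N; under eq_fun do rewrite normsqC.
by move=> x; exact: continuous_mul_ln_normsq (ci x) (cr x).
Qed.

Lemma continuous_cabs_sqr_ln u : ccontinuous u ->
  continuous (fun x => cabs (u x) ^+ 2 * ln (cabs (u x) ^+ 2)).
Proof.
move=> cu; have [cr ci] := cu.
have -> : (fun x => cabs (u x) ^+ 2 * ln (cabs (u x) ^+ 2)) = fun x =>
    Re (u x) * (cdot (u x) 1 * ln (cabs (u x) ^+ 2)) +
    Im (u x) * (cdot (u x) (0 +i* 1) * ln (cabs (u x) ^+ 2)).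
  by apply/funext => x; rewrite cdotz1 cdotzi {1}cabs_sqr; ring.
by apply: continuous_add; apply: continuous_mul => //;
  exact: continuous_cdotr_ln.
Qed.

Lemma measurable_cdot u v : cmeasurable u -> cmeasurable v ->
  measurable_fun setT (fun x => cdot (u x) (v x)).
Proof.
move=> [ur ui] [vr vi]; under eq_fun do rewrite cdotE.
by apply: measurable_funD; exact: measurable_funM.
Qed.

Lemma measurable_ln_cabs_sqr u : cmeasurable u ->
  measurable_fun setT (fun x => ln (cabs (u x) ^+ 2)).
Proof.
move=> [ur ui]; apply: measurableT_comp; first exact: measurable_ln.
under eq_fun do rewrite cabs_sqr.
by apply: measurable_funD; exact: measurable_funX.
Qed.

Lemma cae_eqP u v : cae_eq u v <->
  {ae mu, forall x, Re (u x) = Re (v x)} /\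
  {ae mu, forall x, Im (u x) = Im (v x)}.
Proof.
split=> [uv|[]]; last by apply: ae_imp2 => x; exact: complex_eqP.
by split; apply: ae_imp uv => x ->.
Qed.

Lemma cae_eq_sym u v : cae_eq u v -> cae_eq v u.
Proof. exact: ae_imp. Qed.

Lemma cae_eq_trans u v w : cae_eq u v -> cae_eq v w -> cae_eq u w.
Proof. by apply: ae_imp2 => x -> ->. Qed.

Lemma cL2P u : cL2 u <-> L2 (fun x => Re (u x)) /\ L2 (fun x => Im (u x)).
Proof.
split=> [[[mr mi] iu]|[[mr ir] [mi ii]]].
  by split; split=> //; apply: (le_Rintegrable _ _ _ iu) => //;
    do ?exact: measurable_funX;
    move=> x _; rewrite cabs_sqr ger0_norm ?sqr_ge0// ?lerDl ?lerDr sqr_ge0.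
split=> //; under eq_fun do rewrite cabs_sqr.
exact: RintegrableD.
Qed.

Lemma ae_eq_cL2 u v : cmeasurable v -> cae_eq u v -> cL2 u -> cL2 v.
Proof.
move=> [mr mi] /cae_eqP[er ei] /cL2P[Lr Li]; apply/cL2P.
by split; [exact: ae_eq_L2 Lr|exact: ae_eq_L2 Li].
Qed.

Lemma cL2Z c f : L2 f -> cL2 (fun x => c * (f x)%:C).
Proof.
by move=> Lf; apply/cL2P; rewrite ReZ ImZ; split; exact: L2Z.
Qed.

Lemma L2_cdotr u c : cL2 u -> L2 (fun x => cdot (u x) c).
Proof.
move=> /cL2P[Lr Li]; under eq_fun do
  rewrite cdotE [_ * Re c]mulrC [_ * Im c]mulrC.
by apply: L2D; exact: L2Z.
Qed.

Lemma is_weak_derivativeP u v : is_weak_derivative u v <->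
  weak_derivative (fun x => Re (u x)) (fun x => Re (v x)) /\
  weak_derivative (fun x => Im (u x)) (fun x => Im (v x)).
Proof.
have eRe f w : \int[mu]_x Re (w x * (f x)%:C) = \int[mu]_x (Re (w x) * f x).
  by apply: eq_Rintegral => x _; rewrite ReZr.
have eIm f w : \int[mu]_x Im (w x * (f x)%:C) = \int[mu]_x (Im (w x) * f x).
  by apply: eq_Rintegral => x _; rewrite ImZr.
split=> [uv|[uvr uvi] psi tpsi].
  by split=> psi tpsi; have := uv psi tpsi; rewrite /cintegral !eRe !eIm => -[].
by rewrite /cintegral !eRe !eIm uvr// uvi.
Qed.

Lemma is_weak_derivativeZ c f g : locint f -> locint g -> weak_derivative f g ->
  is_weak_derivative (fun x => c * (f x)%:C) (fun x => c * (g x)%:C).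
Proof.
by move=> lf lg fg; apply/is_weak_derivativeP; rewrite !ReZ !ImZ; split;
  exact: weak_derivativeZ.
Qed.

Lemma weak_derivative_cdotr u v c : cL2 u -> cL2 v -> is_weak_derivative u v ->
  weak_derivative (fun x => cdot (u x) c) (fun x => cdot (v x) c).
Proof.
move=> /cL2P[ur ui] /cL2P[vr vi] /is_weak_derivativeP[uvr uvi].
have cdotl w : (fun x => cdot (w x) c) =
    fun x => Re c * Re (w x) + Im c * Im (w x).
  by apply/funext => x; rewrite cdotE [Re c * _]mulrC [Im c * _]mulrC.
rewrite !cdotl; apply: weak_derivativeD;
  do ?exact: L2_locally_integrable (L2Z _ _).
  by apply: weak_derivativeZ => //; exact: L2_locally_integrable.
by apply: weak_derivativeZ => //; exact: L2_locally_integrable.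
Qed.

Lemma is_weak_derivative_ae_eq u1 u2 v : cmeasurable u1 -> cmeasurable u2 ->
  cmeasurable v -> cae_eq u1 u2 ->
  is_weak_derivative u1 v -> is_weak_derivative u2 v.
Proof.
move=> [ur1 ui1] [ur2 ui2] [vr vi] /cae_eqP[er ei]
  /is_weak_derivativeP[uvr uvi].
apply/is_weak_derivativeP; split.
  by apply: weak_derivative_ae_eq uvr => //; exact: aeW.
by apply: weak_derivative_ae_eq uvi => //; exact: aeW.
Qed.

Lemma is_weak_derivative_unique u v1 v2 : cL2 v1 -> cL2 v2 ->
  is_weak_derivative u v1 -> is_weak_derivative u v2 -> cae_eq v1 v2.
Proof.
move=> /cL2P[/L2_locally_integrable lr1 /L2_locally_integrable li1].
move=> /cL2P[/L2_locally_integrable lr2 /L2_locally_integrable li2].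
move=> /is_weak_derivativeP[ur1 ui1] /is_weak_derivativeP[ur2 ui2];
  apply/cae_eqP.
split; first exact: weak_derivative_unique ur1 ur2.
exact: weak_derivative_unique ui1 ui2.
Qed.

Lemma is_weak_derivative_ccontinuous u v : cL2 u -> cL2 v ->
  is_weak_derivative u v -> exists2 w, ccontinuous w & cae_eq w u.
Proof.
move=> /cL2P[/L2_locally_integrable lur /L2_locally_integrable lui].
move=> /cL2P[/L2_locally_integrable lvr /L2_locally_integrable lvi].
move=> /is_weak_derivativeP[uvr uvi].
have [cr er] := weak_derivative_primitive lur lvr uvr.
have [ci ei] := weak_derivative_primitive lui lvi uvi.
exists (fun x => (cr + primitive (fun t => Re (v t)) x) +i*
                 (ci + primitive (fun t => Im (v t)) x)).
  by split; apply: continuous_add (primitive_continuous _) => //;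
    exact: continuous_cst.
by apply/cae_eqP; split; [apply: ae_imp er => x ->|apply: ae_imp ei => x ->].
Qed.

Lemma ccontinuous_ae_eq u v : ccontinuous u -> ccontinuous v -> cae_eq u v ->
  u = v.
Proof.
move=> [ur ui] [vr vi] /cae_eqP[er ei].
have Re_eq := ae_eq_continuous ur vr er.
have Im_eq := ae_eq_continuous ui vi ei.
apply/funext => x; apply: complex_eqP.
  exact: (congr1 (fun f => f x) Re_eq).
exact: (congr1 (fun f => f x) Im_eq).
Qed.

End complex_functions.

Section H1_pairs.
Variable R : realType.
Local Notation Re := complex.Re.
Local Notation Im := complex.Im.
Implicit Types (u v w phi : R -> R[i]) (psi : R -> R) (c : R[i]).

Definition H1_pair u v phi :=
  [/\ ccontinuous u, cae_eq u phi, cL2 u, cL2 v & is_weak_derivative u v].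

Lemma H1_pair_crepr_wderiv phi : H1 phi -> H1_pair (crepr phi) (wderiv phi) phi.
Proof.
move=> [Lphi ex_v].
have [Lv phiv] : cL2 (wderiv phi) /\ is_weak_derivative phi (wderiv phi).
  exact: (xgetPex (fun=> 0) ex_v).
have [w [cwr cwi] wphi] := is_weak_derivative_ccontinuous Lphi Lv phiv.
have [cr ci uphi] :=
  xgetPex (fun=> 0) (ex_intro [set w | [/\ continuous (fun x => Re (w x)),
  continuous (fun x => Im (w x)) & cae_eq w phi]] w (And3 cwr cwi wphi)).
have umeas : cmeasurable (crepr phi) by apply: ccontinuous_cmeasurable; split.
have [mphi _] := Lphi; have [mv _] := Lv.
split=> //; first exact: ae_eq_cL2 (cae_eq_sym uphi) Lphi.
exact: is_weak_derivative_ae_eq (cae_eq_sym uphi) phiv.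
Qed.

Section uniqueness.
Variables u v phi : R -> R[i].
Hypotheses (mphi : cmeasurable phi) (uv : H1_pair u v phi).

Let weak_derivative_pair : is_weak_derivative phi v.
Proof.
case: uv => cu uphi _ [mv _]; apply: is_weak_derivative_ae_eq => //.
exact: ccontinuous_cmeasurable.
Qed.

Lemma H1_pair_H1 : H1 phi.
Proof.
case: uv => cu uphi Lu Lv _; split; first exact: ae_eq_cL2 uphi Lu.
by exists v.
Qed.

Lemma H1_pair_crepr : crepr phi = u.
Proof.
case: uv => cu uphi _ _ _.
have [cr rphi _ _ _] := H1_pair_crepr_wderiv H1_pair_H1.
exact: ccontinuous_ae_eq (cae_eq_trans rphi (cae_eq_sym uphi)).
Qed.

Lemma H1_pair_wderiv : cae_eq (wderiv phi) v.
Proof.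
case: uv => _ _ _ Lv _.
have [Lw phiw] : cL2 (wderiv phi) /\ is_weak_derivative phi (wderiv phi).
  by have [_ ex_v] := H1_pair_H1; exact: (xgetPex (fun=> 0) ex_v).
exact: is_weak_derivative_unique phiw weak_derivative_pair.
Qed.

End uniqueness.

Lemma H1_pair_test c psi : test_function psi ->
  H1_pair (fun x => c * (psi x)%:C) (fun x => c * (psi^`() x)%:C)
          (fun x => c * (psi x)%:C).
Proof.
move=> tpsi; have tpsi' := test_derive1 tpsi; have spsi := test_smooth tpsi.
split; [exact/ccontinuousZ/smooth_continuous|exact: aeW
       |exact/cL2Z/L2_test|exact/cL2Z/L2_test|].
by apply: is_weak_derivativeZ (weak_derivative_smooth spsi);
  exact/L2_locally_integrable/L2_test.
Qed.

Lemma W_test c psi : test_function psi -> W (fun x => c * (psi x)%:C).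
Proof.
move=> tpsi; have psi_pair := H1_pair_test c tpsi.
have [cu _ [umeas _] _ _] := psi_pair.
split; first exact: H1_pair_H1 umeas psi_pair.
have [_ [M psiM]] := (test_functionP psi).1 tpsi.
apply: (@integrable_supported_in _ M).
  exact/continuous_locally_integrable/continuous_cabs_sqr_ln.
by move=> x /psiM psi0; rewrite cabs_sqrZ psi0 expr0n mulr0 mul0r.
Qed.

End H1_pairs.

(** * The stationary equation *)

Section weak_form.
Variable R : realType.
Local Notation mu := (@lebesgue_measure R).
Local Notation Re := complex.Re.
Implicit Types (gamma omega : R) (u v g w h phi : R -> R[i]).

Definition weak_form gamma omega u v g w : R :=
  \int[mu]_x cdot (v x) (w x) + omega * \int[mu]_x cdot (u x) (g x)
  - \int[mu]_x (ln (cabs (u x) ^+ 2) * cdot (u x) (g x))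
  - gamma * cdot (u 0) (g 0).

Lemma stationary_weak_form gamma omega phi u v : cmeasurable phi ->
  H1_pair u v phi ->
  stationary gamma omega phi <->
  forall h g w, W h -> H1_pair g w h -> weak_form gamma omega u v g w = 0.
Proof.
move=> mphi uv; have [cu uphi _ [mv _] _] := uv.
have umeas := ccontinuous_cmeasurable cu.
have [_ _ _ [mphi' _] _] := H1_pair_crepr_wderiv (H1_pair_H1 mphi uv).
have ReD (a b : R[i]) : Re (a + b) = Re a + Re b by case: a b => [? ?] [? ?].
have ReN (a : R[i]) : Re (- a) = - Re a by case: a => [? ?].
have ReZ (r : R) (a : R[i]) : Re (r%:C * a) = r * Re a.
  by rewrite mulrC ReZr mulrC.
have formE h g w : W h -> H1_pair g w h ->
    Re (cintegral (fun x => wderiv phi x * (wderiv h x)^*)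
       + omega%:C * cintegral (fun x => phi x * (h x)^*)
       - cintegral (fun x => phi x * (ln (cabs (phi x) ^+ 2))%:C * (h x)^*))
    - gamma * Re (crepr phi 0 * (crepr h 0)^*) = weak_form gamma omega u v g w.
  move=> [[[mh _] _] _] gw; have [cg gh _ [mw _] _] := gw.
  have mg := ccontinuous_cmeasurable cg.
  have [_ _ _ [mh' _] _] := H1_pair_crepr_wderiv (H1_pair_H1 mh gw).
  have cdot_uphi : {ae mu, forall x, cdot (phi x) (h x) = cdot (u x) (g x)}.
    by apply: ae_imp2 uphi gh => x -> ->.
  rewrite (H1_pair_crepr mphi uv) (H1_pair_crepr mh gw) !ReD ReN ReZ.
  rewrite /cintegral /= /weak_form.
  congr (_ + _ * _ - _ - _).
  - apply: ae_eq_Rintegral; do ?exact: measurable_cdot.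
    by apply: ae_imp2 (H1_pair_wderiv mphi uv) (H1_pair_wderiv mh gw)
      => x -> ->.
  - by apply: ae_eq_Rintegral; do ?exact: measurable_cdot.
  - transitivity (\int[mu]_x (ln (cabs (phi x) ^+ 2) * cdot (phi x) (h x))).
      by apply: eq_Rintegral => x _; rewrite -[LHS]/(cdot _ _) cdotZl.
    apply: ae_eq_Rintegral; do ?[apply: measurable_funM;
      [exact: measurable_ln_cabs_sqr|exact: measurable_cdot]].
    by apply: ae_imp2 uphi cdot_uphi => x -> ->.
split=> [st h g w Wh gw|form0 h Wh].
  by rewrite -(formE h g w Wh gw); exact: st.
have gw := H1_pair_crepr_wderiv (proj1 Wh).
by rewrite (formE h _ _ Wh gw); exact: form0 gw.
Qed.

End weak_form.

Section gausson_solution.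
Variables (R : realType) (gamma omega : R) (k : R[i]).
Local Notation mu := (@lebesgue_measure R).
Local Notation a := (gamma / 2).
Hypothesis k_sqr : cabs k ^+ 2 = expR (omega + 1).

Local Notation u := (fun x => k * (gausson a x)%:C).
Local Notation v := (fun x => k * (gausson1 a x)%:C).

Variable phi : R -> R[i].
Hypotheses (mphi : cmeasurable phi) (phiE : cae_eq phi u).

Let phi_pair : H1_pair u v phi.
Proof.
have [LS LS1] := (@L2_gausson R a, @L2_gausson1 R a).
split; [exact/ccontinuousZ/gausson_continuous|exact: cae_eq_sym
       |exact: cL2Z|exact: cL2Z|].
by apply: is_weak_derivativeZ (@weak_derivative_gausson R a);
  exact: L2_locally_integrable.
Qed.

Let ln_cabs_sqr x : ln (cabs (u x) ^+ 2) = omega + 1 + ln (gausson a x ^+ 2).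
Proof.
have S2 : 0 < gausson a x ^+ 2 by rewrite exprn_gt0// gausson_gt0.
by rewrite cabs_sqrZ k_sqr lnM ?posrE ?expR_gt0// expRK.
Qed.

Let ln_mul_gausson x :
  ln (cabs (u x) ^+ 2) * gausson a x = omega * gausson a x - gausson2 a x.
Proof. by rewrite ln_cabs_sqr gausson_ode; ring. Qed.

Lemma gausson_W : W phi.
Proof.
split; first exact: H1_pair_H1 phi_pair.
have [LS LS2] := (@L2_gausson R a, @L2_gausson2 R a).
have cu : ccontinuous u by case: phi_pair.
have iu : mu.-integrable setT
  (EFin \o (fun x => cabs (u x) ^+ 2 * ln (cabs (u x) ^+ 2))).
  have := RintegrableZ measurableT (expR (omega + 1))
    (RintegrableB measurableT (RintegrableZ measurableT omega (L2M LS LS))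
    (L2M LS LS2)).
  apply: eq_integrable => // x _ /=; congr EFin.
  transitivity (expR (omega + 1) * gausson a x *
    (ln (cabs (u x) ^+ 2) * gausson a x)).
    by rewrite ln_mul_gausson; ring.
  have u_sqr : cabs (u x) ^+ 2 = expR (omega + 1) * gausson a x ^+ 2.
    by rewrite cabs_sqrZ k_sqr.
  by rewrite [X in _ = X * _]u_sqr; ring.
apply: ae_eq_integrable iu; last by apply: ae_imp phiE => x ->.
apply: measurable_funM; last exact: measurable_ln_cabs_sqr.
by case: mphi => mr mi; under eq_fun do rewrite cabs_sqr;
  apply: measurable_funD; exact: measurable_funX.
Qed.

Lemma gausson_nontrivial : nontrivial phi.
Proof.
move=> phi0; have [x _ /esym ux0] :=
  ae_itv_exists ltr01 (cae_eq_trans (cae_eq_sym phi0) phiE).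
have : 0 < cabs (u x) ^+ 2.
  by rewrite cabs_sqrZ k_sqr mulr_gt0 ?expR_gt0// exprn_gt0// gausson_gt0.
by rewrite ux0 cabs_sqr /= expr0n addr0 ltxx.
Qed.

Lemma gausson_stationary : stationary gamma omega phi.
Proof.
apply/(stationary_weak_form _ _ mphi phi_pair) => h g w _ [cg _ Lg Lw gw].
have LS := @L2_gausson R a; have LS1 := @L2_gausson1 R a.
have LS2 := @L2_gausson2 R a.
have Lgk := L2_cdotr k Lg; have Lwk := L2_cdotr k Lw.
have := gausson_by_parts a (@continuous_cdotr _ _ k cg) Lgk Lwk
  (weak_derivative_cdotr k Lg Lw gw).
have iS := L2M LS Lgk; have iS2 := L2M Lgk LS2; have iS1 := L2M Lwk LS1.
have a2 : 2 * a = gamma by field.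
rewrite RintegralD// a2 addrC => parts; rewrite /weak_form.
under eq_Rintegral do rewrite cdotZl cdotC mulrC.
under [X in omega * X]eq_Rintegral do rewrite cdotZl cdotC.
rewrite (_ : \int[mu]_x (ln _ * _) =
  omega * \int[mu]_x (gausson a x * cdot (g x) k)
    - \int[mu]_x (cdot (g x) k * gausson2 a x)); last first.
  rewrite -RintegralZl// -RintegralB//; last exact: RintegrableZ.
  by apply: eq_Rintegral => x _; rewrite cdotZl cdotC mulrA ln_mul_gausson;
    ring.
by rewrite cdotZl cdotC mulrA -parts opprB addrACA subrr addr0 subrr.
Qed.

End gausson_solution.

Section jump.
Variable R : realType.
Local Notation mu := (@lebesgue_measure R).
Local Notation locint := (locally_integrable [set: R]).
Implicit Types (u v V G psi : R -> R) (c x : R).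

Lemma weak_derivative_jump v G c : locint v -> continuous G ->
  (forall psi, test_function psi ->
    \int[mu]_x (v x * psi^`() x) + \int[mu]_x (G x * psi x) = c * psi 0) ->
  exists V, [/\ continuous V, forall x, is_derive x 1 V (G x) &
    {ae mu, forall x, v x = glue (fun y => V y - c) V x}].
Proof.
move=> lv cG vG; have lG := continuous_locally_integrable cG.
pose H x : R := \1_(`]0%R, +oo[%classic) x.
have lH : locint H by apply: locally_integrable_indic => //; exact: openT.
have lHc : locint (fun x => H x * c) :=
  locally_integrableM lH (@continuous_cst R c).
have lvH : locint (fun x => v x + H x * c) by exact: locally_integrableD.
have vH_G : weak_derivative (fun x => v x + H x * c) G.
  move=> psi tpsi; have tpsi' := test_derive1 tpsi.
  under eq_Rintegral do rewrite mulrDl.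
  rewrite RintegralD//; [|exact: integrable_test|exact: integrable_test].
  have -> : \int[mu]_x (H x * c * psi^`() x) = - (c * psi 0).
    rewrite -mulrN -Rintegral_derive1_test_gt// -RintegralZl//.
      by rewrite -[RHS]Rintegral_mul_indic; apply: eq_Rintegral => x _;
        rewrite /H; ring.
    exact: integrableS (test_integrable tpsi').
  by rewrite -(vG psi tpsi); ring.
have [k vHE] := weak_derivative_primitive lvH lG vH_G.
exists (fun x => k + primitive G x); split.
- by apply: continuous_add; [exact: continuous_cst|exact: primitive_continuous].
- move=> x; apply: (is_derive_eq (is_derive1D (is_derive_cst k x 1)
    (is_derive_primitive lG (cG x)))).
  by rewrite add0r.
- apply: ae_imp vHE => x vHx; rewrite /glue -vHx /H indicE.
  rewrite mem_setE in_itv/= andbT.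
  by case: ltP => _; rewrite ?mul1r ?mul0r ?addr0 ?addrK.
Qed.

Lemma is_derive_jump u v V c x : continuous u -> locint v ->
  weak_derivative u v -> continuous V ->
  {ae mu, forall y, v y = glue (fun y => V y - c) V y} -> x != 0 ->
  is_derive x 1 u (glue (fun y => V y - c) V x).
Proof.
move=> cu lv uv cV vE x0.
have cVc : continuous (fun y => V y - c) := continuous_sub_cst cV.
apply: (is_derive_weak_derivative cu lv (locally_integrable_glue cVc cV) uv vE).
move: x0; rewrite neq_lt /prop_for /continuous_at => /orP[x0|x0].
  rewrite -(nbhs_singleton (near_glue_lt (fun y => V y - c) V x0)).
  by apply: cvg_trans (cV x); exact: near_eq_cvg (near_glue_lt _ _ x0).
rewrite -(nbhs_singleton (near_glue_gt (fun y => V y - c) V x0)).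
by apply: cvg_trans (cVc x); exact: near_eq_cvg (near_glue_gt _ _ x0).
Qed.

End jump.

Section gaussian_gluing.
Variables (R : realType) (gamma E : R) (p q V1 V2 : R -> R)
  (a b k1 k2 l1 l2 : R).
Hypotheses (gamma_neq0 : gamma != 0).
Hypotheses (cp : continuous p) (cq : continuous q) (cV1 : continuous V1)
  (cV2 : continuous V2).
Hypothesis k_sqr : k1 ^+ 2 + k2 ^+ 2 = 0 \/ k1 ^+ 2 + k2 ^+ 2 = E.
Hypothesis l_sqr : l1 ^+ 2 + l2 ^+ 2 = 0 \/ l1 ^+ 2 + l2 ^+ 2 = E.
Hypothesis right : forall x, 0 < x ->
  [/\ p x = k1 * gaussian a x, q x = k2 * gaussian a x,
  V1 x - gamma * p 0 = - (x + a) * p x & V2 x - gamma * q 0 = - (x + a) * q x].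
Hypothesis left : forall x, x < 0 ->
  [/\ p x = l1 * gaussian b x, q x = l2 * gaussian b x,
  V1 x = - (x + b) * p x & V2 x = - (x + b) * q x].
Hypothesis pq_neq0 : ~ (forall x, p x = 0 /\ q x = 0).

Let cgauss k c : continuous (fun x => k * gaussian c x : R).
Proof.
by apply: continuous_mul;
  [exact: continuous_cst|exact/smooth_continuous/smooth_gaussian].
Qed.

Let cmul (f : R -> R) c : continuous f ->
  continuous (fun x : R => - (x + c) * f x).
Proof.
move=> cf; apply: continuous_mul => // x.
exact: is_derive_continuous (is_derive1N (is_derive_addr x c)).
Qed.

Let right0 : [/\ p 0 = k1 * gaussian a 0, q 0 = k2 * gaussian a 0,
  V1 0 - gamma * p 0 = - a * p 0 & V2 0 - gamma * q 0 = - a * q 0].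
Proof.
rewrite -[in - a * p 0](add0r a) -[in - a * q 0](add0r a); split.
- by apply: continuous_eq_gt cp (@cgauss _ _) _ => x /right[].
- by apply: continuous_eq_gt cq (@cgauss _ _) _ => x /right[].
- by apply: (continuous_eq_gt (continuous_sub_cst cV1) (cmul cp)) => x /right[].
- by apply: (continuous_eq_gt (continuous_sub_cst cV2) (cmul cq)) => x /right[].
Qed.

Let left0 : [/\ p 0 = l1 * gaussian b 0, q 0 = l2 * gaussian b 0,
  V1 0 = - b * p 0 & V2 0 = - b * q 0].
Proof.
rewrite -[in - b * p 0](add0r b) -[in - b * q 0](add0r b); split.
- by apply: continuous_eq_lt cp (@cgauss _ _) _ => x /left[].
- by apply: continuous_eq_lt cq (@cgauss _ _) _ => x /left[].
- by apply: (continuous_eq_lt cV1 (cmul cp)) => x /left[].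
- by apply: (continuous_eq_lt cV2 (cmul cq)) => x /left[].
Qed.

Let G0 c : gaussian c 0 != 0 :> R. Proof. exact/lt0r_neq0/gaussian_gt0. Qed.

Let normsq0_right : normsq p q 0 = (k1 ^+ 2 + k2 ^+ 2) * gaussian a 0 ^+ 2.
Proof. by have [pE qE _ _] := right0; rewrite /normsq pE qE; ring. Qed.

Let normsq0_left : normsq p q 0 = (l1 ^+ 2 + l2 ^+ 2) * gaussian b 0 ^+ 2.
Proof. by have [pE qE _ _] := left0; rewrite /normsq pE qE; ring. Qed.

Let normsq0_neq0 : normsq p q 0 != 0.
Proof.
apply/eqP => N0; apply: pq_neq0 => x.
have := normsq0_right; rewrite N0 => /esym/eqP.
rewrite mulf_eq0 expf_eq0/= (negbTE (G0 a)) orbF => /eqP/sqrD_eq0[k10 k20].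
have := normsq0_left; rewrite N0 => /esym/eqP.
rewrite mulf_eq0 expf_eq0/= (negbTE (G0 b)) orbF => /eqP/sqrD_eq0[l10 l20].
have [x0|x0|->] := ltgtP x 0; last exact: normsq_eq0.
  by have [-> -> _ _] := left x0; rewrite l10 l20 !mul0r.
by have [-> -> _ _] := right x0; rewrite k10 k20 !mul0r.
Qed.

Let k_sqrE : k1 ^+ 2 + k2 ^+ 2 = E.
Proof.
by case: k_sqr => // k0; move: normsq0_neq0;
  rewrite normsq0_right k0 mul0r eqxx.
Qed.

Let l_sqrE : l1 ^+ 2 + l2 ^+ 2 = E.
Proof.
by case: l_sqr => // l0; move: normsq0_neq0; rewrite normsq0_left l0 mul0r eqxx.
Qed.

Let jumpE : a - b = gamma.
Proof.
have [_ _ V1r V2r] := right0; have [_ _ V1l V2l] := left0.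
apply/eqP; rewrite -subr_eq0; apply: contraNT normsq0_neq0 => d0.
have p0 : p 0 = 0.
  by apply: (mulfI d0); rewrite mulr0 !mulrBl; move: V1r; rewrite V1l; lra.
have q0 : q 0 = 0.
  by apply: (mulfI d0); rewrite mulr0 !mulrBl; move: V2r; rewrite V2l; lra.
by rewrite /normsq p0 q0 expr0n addr0.
Qed.

Let shiftE : a = gamma / 2 /\ b = - (gamma / 2).
Proof.
have : gaussian a 0 ^+ 2 = gaussian b 0 ^+ 2.
  have E0 : E != 0.
    by apply: contraNneq normsq0_neq0 => E0;
      rewrite normsq0_right k_sqrE E0 mul0r.
  by apply: (mulfI E0); rewrite -{1}k_sqrE -l_sqrE -normsq0_right normsq0_left.
rewrite !gaussian_sqr !add0r => /expR_inj/oppr_inj ab2.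
have ab : a + b = 0.
  by apply: (mulfI gamma_neq0); rewrite mulr0 -jumpE -subr_sqr ab2 subrr.
by have := jumpE; split; lra.
Qed.

Lemma gaussian_gluing : k1 ^+ 2 + k2 ^+ 2 = E /\
  forall x, p x = k1 * gausson (gamma / 2) x /\
    q x = k2 * gausson (gamma / 2) x.
Proof.
split=> // x; have [aE bE] := shiftE.
have [p0r q0r _ _] := right0; have [p0l q0l _ _] := left0.
have Gab : gaussian b 0 = gaussian a 0 :> R.
  by rewrite aE bE /gaussian !add0r sqrrN.
have kl1 : k1 = l1 by apply: (mulIf (G0 a)); rewrite -p0r p0l Gab.
have kl2 : k2 = l2 by apply: (mulIf (G0 a)); rewrite -q0r q0l Gab.
rewrite /gausson /glue -bE -aE; have [x0|x0|->] := ltgtP x 0.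
- by have [-> -> _ _] := left x0; rewrite kl1 kl2.
- by have [-> -> _ _] := right x0.
- by rewrite kl1 kl2.
Qed.

End gaussian_gluing.

Section uniqueness.
Variable R : realType.
Local Notation mu := (@lebesgue_measure R).
Local Notation Re := complex.Re.
Local Notation Im := complex.Im.
Implicit Types (x : R) (psi : R -> R) (c : R[i]).
Variables (gamma omega : R) (phi : R -> R[i]).
Hypothesis gamma_neq0 : gamma != 0.
Hypothesis Wphi : W phi.
Hypothesis nontrivial_phi : nontrivial phi.
Hypothesis stationary_phi : stationary gamma omega phi.

Local Notation u := (crepr phi).
Local Notation v := (wderiv phi).

Let phi_pair : H1_pair u v phi.
Proof. by apply: H1_pair_crepr_wderiv; case: Wphi. Qed.
Let mphi : cmeasurable phi. Proof. by case: Wphi => -[[]]. Qed.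
Let cu : ccontinuous u. Proof. by case: phi_pair. Qed.
Let Lv : cL2 v. Proof. by case: phi_pair. Qed.

Let force c x := omega * cdot (u x) c - cdot (u x) c * ln (cabs (u x) ^+ 2).

Let continuous_force c : continuous (force c).
Proof.
apply: continuous_add; last exact/continuous_opp/continuous_cdotr_ln.
by apply: continuous_mul; [exact: continuous_cst|exact: continuous_cdotr].
Qed.

Let weak_equation c psi : test_function psi ->
  \int[mu]_x (cdot (v x) c * psi^`() x) + \int[mu]_x (force c x * psi x) =
  gamma * cdot (u 0) c * psi 0.
Proof.
move=> tpsi.
have := (stationary_weak_form _ _ mphi phi_pair).1 stationary_phi _ _ _
  (W_test c tpsi) (H1_pair_test c tpsi).
have lu := continuous_locally_integrable (@continuous_cdotr _ _ c cu).
have luln := continuous_locally_integrable (@continuous_cdotr_ln _ _ c cu).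
have iu := integrable_test lu tpsi; have iuln := integrable_test luln tpsi.
rewrite /weak_form cdotZr; under eq_Rintegral do rewrite cdotZr.
under [X in omega * X]eq_Rintegral do rewrite cdotZr.
under [X in _ - X - _]eq_Rintegral do rewrite cdotZr mulrA [ln _ * _]mulrC.
rewrite -addrA -addrA [_ + (- _ - _)]addrA => /eqP;
  rewrite addrA subr_eq0 mulrA => /eqP <-.
congr (_ + _); rewrite -RintegralZl// -RintegralB//; last exact: RintegrableZ.
by apply: eq_Rintegral => x _; rewrite /force; ring.
Qed.

Lemma stationary_regular c : exists V : R -> R,
  let D := glue (fun x => V x - gamma * cdot (u 0) c) V in
  [/\ continuous V, {ae mu, forall x, cdot (v x) c = D x},
    forall x, x != 0 -> is_derive x 1 (fun y => cdot (u y) c) (D x) &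
    forall x, x != 0 ->
      is_derive x 1 D ((omega - ln (cabs (u x) ^+ 2)) * cdot (u x) c)].
Proof.
have lvc := L2_locally_integrable (L2_cdotr c Lv).
have [V [cV dV vE]] := weak_derivative_jump lvc (@continuous_force c)
  (@weak_equation c).
exists V => /=; split=> // x x0.
  apply: is_derive_jump lvc _ cV vE x0; first exact: continuous_cdotr.
  by case: phi_pair => _ _ Lu _ uv; exact: weak_derivative_cdotr.
have dVc : is_derive x 1 (fun y => V y - gamma * cdot (u 0) c) (force c x).
  by apply: (is_derive_eq (is_derive1D (dV x) (is_derive_cst _ x 1)));
    rewrite addr0.
apply: (is_derive_eq (is_derive_glue x0 dVc (dV x))).
by rewrite /glue /force; case: ifP => _; ring.
Qed.

Let p x := Re (u x).
Let q x := Im (u x).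

Let normsqE x : normsq p q x = cabs (u x) ^+ 2. Proof. by rewrite cabs_sqr. Qed.

Let pE : {ae mu, forall x, Re (phi x) = p x}.
Proof. by case: phi_pair => _ /cae_eq_sym/cae_eqP[]. Qed.

Let qE : {ae mu, forall x, Im (phi x) = q x}.
Proof. by case: phi_pair => _ /cae_eq_sym/cae_eqP[]. Qed.

Let integrable_normsq : mu.-integrable setT (EFin \o normsq p q).
Proof.
case: phi_pair => _ _ /cL2P[[_ ip] [_ iq]] _ _;
  exact: (RintegrableD measurableT ip iq).
Qed.

Let integrable_normsq_ln :
  mu.-integrable setT (EFin \o (fun x => normsq p q x * ln (normsq p q x))).
Proof.
have eq_ln : (fun x => normsq p q x * ln (normsq p q x)) =
    fun x => cabs (u x) ^+ 2 * ln (cabs (u x) ^+ 2).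
  by apply/funext => x; rewrite normsqE.
case: Wphi => _; rewrite eq_ln; apply: ae_eq_integrable.
  exact: continuous_measurable_fun (continuous_cabs_sqr_ln cu).
by case: phi_pair => _ uphi _ _ _; apply: ae_imp uphi => x ->.
Qed.

Lemma stationary_half_lines :
  exists V1 V2 : R -> R, [/\ continuous V1, continuous V2 &
  forall I : set R, open I -> is_interval I -> mu I = +oo%E -> ~ I 0 ->
  exists a k1 k2 : R,
    (k1 ^+ 2 + k2 ^+ 2 = 0 \/ k1 ^+ 2 + k2 ^+ 2 = expR (omega + 1)) /\
    forall x, I x -> [/\ p x = k1 * gaussian a x, q x = k2 * gaussian a x,
      glue (fun y => V1 y - gamma * p 0) V1 x = - (x + a) * p x &
      glue (fun y => V2 y - gamma * q 0) V2 x = - (x + a) * q x]].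
Proof.
have cdot1 (w : R -> R[i]) : (fun x => cdot (w x) 1) = fun x => Re (w x).
  by apply/funext => x; exact: cdotz1.
have cdoti (w : R -> R[i]) :
  (fun x => cdot (w x) (0 +i* 1)) = fun x => Im (w x).
  by apply/funext => x; exact: cdotzi.
have [V1 /= [cV1 v1E dp dP]] := stationary_regular 1.
have [V2 /= [cV2 v2E dq dQ]] := stationary_regular (0 +i* 1).
rewrite cdotz1 cdot1 -/p in v1E dp dP; rewrite cdotzi cdoti -/q in v2E dq dQ.
exists V1, V2; split=> // I oI itvI muI I0.
have I_neq0 x : I x -> x != 0.
  by move=> Ix; apply/eqP => x0; apply: I0; rewrite -x0.
have mI : measurable I by exact: open_measurable.
apply: (log_ode_gaussian oI itvI muI (P :=
  glue (fun y => V1 y - gamma * p 0) V1)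
  (Q := glue (fun y => V2 y - gamma * q 0) V2)).
- by move=> x /I_neq0/dp.
- by move=> x /I_neq0/dq.
- by move=> x /I_neq0/dP; rewrite cdotz1 normsqE.
- by move=> x /I_neq0/dQ; rewrite cdotzi normsqE.
- exact: integrableS integrable_normsq.
- exact: integrableS integrable_normsq_ln.
- have /cL2P[[_ iv1] [_ iv2]] := Lv.
  apply: integrableS
    (ae_eq_integrable _ _ (RintegrableD measurableT iv1 iv2)) => //.
    by apply: measurable_funD; apply: measurable_funX;
      apply: locally_integrable_measurable;
      apply: locally_integrable_glue => //;
      exact: continuous_sub_cst.
  by apply: ae_imp2 v1E v2E => x; rewrite cdotz1 cdotzi /normsq => -> ->.
Qed.

Lemma stationary_gausson : exists2 k : R[i], cabs k ^+ 2 = expR (omega + 1) &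
  cae_eq phi (fun x => k * (gausson (gamma / 2) x)%:C).
Proof.
have [V1 [V2 [cV1 cV2 half_line]]] := stationary_half_lines.
have [||||a [k1 [k2 [k_sqr right]]]] := half_line `]0, +oo[%classic.
- exact: interval_open.
- exact: interval_is_interval.
- by rewrite lebesgue_measure_itv/= ltry sube0.
- by rewrite /= in_itv/= ltxx.
have [||||b [l1 [l2 [l_sqr left]]]] := half_line `]-oo, 0[%classic.
- exact: interval_open.
- exact: interval_is_interval.
- by rewrite lebesgue_measure_itv/= ltNyr.
- by rewrite /= in_itv/= ltxx.
have [cp cq] := cu.
have [|||kE pqE] := @gaussian_gluing R gamma (expR (omega + 1)) p q V1 V2
  a b k1 k2 l1 l2
  gamma_neq0 cp cq cV1 cV2 k_sqr l_sqr.
- by move=> x x0; have := right x; rewrite /= in_itv/= x0 /glue x0; exact.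
- by move=> x x0; have := left x; rewrite /= in_itv/= x0 /glue ltNge (ltW x0);
    exact.
- move=> pq0; apply: nontrivial_phi; apply/cae_eqP; split.
    by apply: ae_imp pE => x ->; have [] := pq0 x.
  by apply: ae_imp qE => x ->; have [] := pq0 x.
exists (k1 +i* k2); first by rewrite cabs_sqr.
apply/cae_eqP; split.
  by apply: ae_imp pE => x ->; rewrite ReZr; have [] := pqE x.
by apply: ae_imp qE => x ->; rewrite ImZr; have [] := pqE x.
Qed.

End uniqueness.

Section phases.
Variable R : realType.
Implicit Types (omega gamma theta x r : R) (k : R[i]) (phi : R -> R[i]).

Lemma polar_angle (c s : R) : c ^+ 2 + s ^+ 2 = 1 ->
  exists theta, cos theta = c /\ sin theta = s.
Proof.
move=> cs1.
have c1 : -1 <= c <= 1.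
  rewrite -ler_norml -(@expr_le1 _ 2)// -normrX ger0_norm ?sqr_ge0// -cs1.
  by rewrite lerDl sqr_ge0.
have s2 : Num.sqrt (1 - c ^+ 2) = `|s| by rewrite -cs1 addrC addKr sqrtr_sqr.
have cK : cos (acos c) = c by rewrite acosK// in_itv.
have [s0|s0] := leP 0 s.
  by exists (acos c); rewrite cK sin_acos// s2 ger0_norm.
by exists (- acos c); rewrite cosN sinN cK sin_acos// s2 ltr0_norm// opprK.
Qed.

Lemma cexpi_polar k r : 0 < r -> cabs k ^+ 2 = r ^+ 2 ->
  exists theta, k = cexpi theta * r%:C.
Proof.
move=> r0; rewrite cabs_sqr => kr; have rn0 := lt0r_neq0 r0.
have [|theta [ckE skE]] := @polar_angle (complex.Re k / r) (complex.Im k / r).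
  by rewrite !exprMn -mulrDl kr -exprMn divff ?expr1n.
by exists theta; apply: complex_eqP; rewrite (ReZr, ImZr) /= (ckE, skE) divfK.
Qed.

Lemma cabs_cexpi theta r : cabs (cexpi theta * r%:C) ^+ 2 = r ^+ 2.
Proof. by rewrite cabs_sqrZ cabs_sqr /= cos2Dsin2 mul1r. Qed.

Let amplitude omega : R := expR ((omega + 1) / 2).

Let amplitude_sqr omega : amplitude omega ^+ 2 = expR (omega + 1).
Proof. by rewrite /amplitude -expRM_natl mulrC divfK. Qed.

Let phi_solE omega gamma x :
  phi_sol omega gamma x = (amplitude omega)%:C * (gausson (gamma / 2) x)%:C.
Proof. by rewrite /phi_sol gaussonE rmorphM. Qed.

Lemma phi_sol_gt0 omega gamma x : 0 < phi_sol omega gamma x.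
Proof. by rewrite phi_solE -rmorphM ltcR mulr_gt0 ?expR_gt0 ?gausson_gt0. Qed.

Lemma cmeasurable_phi_sol omega gamma : cmeasurable (phi_sol omega gamma).
Proof.
rewrite (_ : phi_sol _ _ =
  fun x => (amplitude omega)%:C * (gausson (gamma / 2) x)%:C).
  exact/ccontinuous_cmeasurable/ccontinuousZ/gausson_continuous.
by apply/funext => x; exact: phi_solE.
Qed.

Lemma phase_solution gamma omega theta phi : cmeasurable phi ->
  cae_eq phi (fun x => cexpi theta * phi_sol omega gamma x) ->
  [/\ W phi, nontrivial phi & stationary gamma omega phi].
Proof.
move=> mphi phiE; pose k := cexpi theta * (amplitude omega)%:C.
have k_sqr : cabs k ^+ 2 = expR (omega + 1) by rewrite cabs_cexpi amplitude_sqr.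
have phi_k : cae_eq phi (fun x => k * (gausson (gamma / 2) x)%:C).
  by apply: ae_imp phiE => x ->; rewrite phi_solE mulrA.
split.
- exact: (gausson_W k_sqr mphi phi_k).
- exact: (gausson_nontrivial k_sqr phi_k).
- exact: (gausson_stationary k_sqr mphi phi_k).
Qed.

Lemma solution_phase gamma omega phi : gamma != 0 ->
  W phi -> nontrivial phi -> stationary gamma omega phi ->
  exists theta, cae_eq phi (fun x => cexpi theta * phi_sol omega gamma x).
Proof.
move=> gamma0 Wphi nontriv stat.
have [k k_sqr phiE] := stationary_gausson gamma0 Wphi nontriv stat.
rewrite -amplitude_sqr in k_sqr.
have [theta kE] := cexpi_polar (expR_gt0 _) k_sqr.
by exists theta; apply: ae_imp phiE => x ->; rewrite phi_solE mulrA -kE.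
Qed.

Lemma cexpi_ge0_eq1 theta (z : R[i]) : 0 < z -> 0 <= cexpi theta * z ->
  cexpi theta = 1.
Proof.
move=> z0; rewrite pmulr_lge0// lecE /= => /andP[/eqP s0 c0].
have := cos2Dsin2 theta; rewrite /cexpi s0 expr0n addr0 => /eqP.
rewrite sqrf_eq1 => /orP[/eqP->//|/eqP c1].
by move: c0; rewrite c1 lerNr oppr0 ler10.
Qed.

End phases.

Theorem proposition3p1 (R : realType) (gamma omega : R) (hgamma : gamma != 0) :
  [/\ [/\ W (phi_sol omega gamma), nonnegative (phi_sol omega gamma),
          nontrivial (phi_sol omega gamma)
        & stationary gamma omega (phi_sol omega gamma)],
      (forall phi : R -> R[i],
          W phi -> nonnegative phi -> nontrivial phi ->
          stationary gamma omega phi -> cae_eq phi (phi_sol omega gamma))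
    & solution_set gamma omega =
      [set phi : R -> R[i] | cmeasurable phi /\
         exists theta : R,
           cae_eq phi (fun x => cexpi theta * phi_sol omega gamma x)]].
Proof.
split.
- have [|Wphi nontriv stat] := @phase_solution R gamma omega 0 _
    (cmeasurable_phi_sol omega gamma).
    by apply: aeW => x; rewrite /cexpi cos0 sin0 mul1r.
  by split=> //; apply: aeW => x; exact/ltW/phi_sol_gt0.
- move=> phi Wphi nonneg nontriv stat.
  have [theta phiE] := solution_phase hgamma Wphi nontriv stat.
  have phi_ge0 : {ae lebesgue_measure, forall x,
      0 <= cexpi theta * phi_sol omega gamma x}.
    by apply: ae_imp2 nonneg phiE => x + <-.
  have [x _ phix_ge0] := ae_itv_exists ltr01 phi_ge0.
  have theta1 := cexpi_ge0_eq1 (phi_sol_gt0 omega gamma x) phix_ge0.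
  by apply: ae_imp phiE => y ->; rewrite theta1 mul1r.
- apply/seteqP; split=> phi.
    by move=> [Wphi nontriv stat]; split;
      [case: Wphi => -[[]]|exact: solution_phase].
  by move=> [mphi [theta phiE]]; exact: phase_solution phiE.
Qed.
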